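(* Let $A$ be a unital commutative $\mathbb R$-algebra with generators $a_1,\dots,a_m$ and with $X(A)\neq\varnothing$. Let $L:A\to\mathbb R$ be a positive semidefinite linear functional with $L(1)=1$. Then there exists a representing positive Radon measure $\mu$ for $L$ with compact support (i.e. $L(a)=\int\alpha(a)\,d\mu(\alpha)$ for all $a\in A$, with $\mu$ a positive Radon measure on $X(A)$ of compact support) if and only if $$v_L(a_1^2+\dots+a_m^2)<\infty.$$ Moreover, in this case $$\operatorname{supp}\mu\subseteq\left\{\alpha\in X(A):|\alpha(a_1)|^2+\dots+|\alpha(a_m)|^2\le v_L(a_1^2+\dots+a_m^2)\right\}.$$
   Context: $\mathbb N_0=\{0,1,2,\dots\}$. For a unital commutative $\mathbb R$-algebra $A$, $X(A)$ denotes the set of all (unital) $\mathbb R$-algebra homomorphisms $A\to\mathbb R$, endowed with the topology of pointwise convergence. A linear functional $L:A\to\mathbb R$ is positive semidefinite if $L(a^2)\ge 0$ for all $a\in A$. Generators means generators of $A$ as a unital $\mathbb R$-algebra. For a positive semidefinite $L$ with $L(1)=1$ and $a\in A$ (with $a^0=1$), define $$v_L(a)=\sqrt{\sup_{n\in\mathbb N_0,\ L(a^{2n})\ne 0}\frac{L(a^{2n+2})}{L(a^{2n})}}\in[0,\infty],$$ with $v_L(a)=\infty$ when the supremum is $\infty$. *)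

(* Defs.v *)
From HB Require Import structures.
From mathcomp Require Import all_boot all_order all_algebra.
From mathcomp Require Import all_classical all_reals all_analysis.
Set Implicit Arguments.
Unset Strict Implicit.
Unset Printing Implicit Defensive.
Import Order.TTheory GRing.Theory Num.Theory.
Import numFieldNormedType.Exports.
Local Open Scope classical_set_scope.
Local Open Scope ring_scope.

Section Radon.
Context {R : realType} {T : ptopologicalType}.

Definition borel := g_sigma_algebraType (@open T).

Implicit Type mu : {measure set borel -> \bar R}.

(* Locally finite and inner regular with respect to compact sets; intended for
   Hausdorff T, where compact sets are closed, hence Borel. *)
Definition radon mu :=
  (forall x : T, exists2 U : set T, open_nbhs x U & (mu U < +oo)%E) /\
  (forall B : set borel, measurable B ->
     mu B = ereal_sup [set mu K | K in [set K : set T | compact K /\ K `<=` B]]).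

Definition supp mu : set T :=
  [set x | forall U : set T, open_nbhs x U -> (0 < mu U)%E].

End Radon.
Arguments borel T : clear implicits.

Section Characters.
Context {R : realType} {A : comAlgType R}.

Definition character := {lrmorphism A -> R | *%R}.

(* X(A). Measurable types are pointed in the library, so the space takes the
   proof of non-emptiness as a parameter. *)
Definition charspace (hX : [set: character] !=set0) : Type := character.

Variable hX : [set: character] !=set0.

HB.instance Definition _ := gen_eqMixin (charspace hX).
HB.instance Definition _ := gen_choiceMixin (charspace hX).
HB.instance Definition _ := isPointed.Build (charspace hX) (projT1 (cid hX)).

Definition char_eval (alpha : charspace hX) : {ptws A -> R} :=
  fun a => (alpha : character) a.

HB.instance Definition _ :=
  Topological.copy (charspace hX) (initial_topology char_eval).

Definition represents (mu : {measure set (borel (charspace hX)) -> \bar R})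
    (L : {scalar A}) :=
  forall a : A,
    mu.-integrable setT (fun alpha => (char_eval alpha a)%:E) /\
    (L a)%:E = (\int[mu]_alpha (char_eval alpha a)%:E)%E.

End Characters.
Arguments character {R} A.
Arguments char_eval {R A hX} alpha.

Section Functionals.
Context {R : realType} {A : comAlgType R}.

Definition generates (m : nat) (a : 'I_m -> A) :=
  forall S : {pred A}, subalg_closed S -> (forall i, a i \in S) ->
    forall x, x \in S.

Definition psd (L : {scalar A}) := forall x : A, 0 <= L (x ^+ 2).

Definition v_ (L : {scalar A}) (a : A) : \bar R :=
  sqrte (ereal_sup
    [set (L (a ^+ (2 * n + 2)) / L (a ^+ (2 * n)))%:E
      | n in [set n : nat | L (a ^+ (2 * n)) != 0]]).

End Functionals.

(* Main.v *)
Require Import Defs.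
From HB Require Import structures.
From mathcomp Require Import all_boot all_order all_algebra.
From mathcomp Require Import ring lra zify.
From mathcomp Require Import all_classical all_reals all_analysis.
From mathcomp Require Import measurable_realfun.
Import Order.TTheory GRing.Theory Num.Theory.
Import numFieldNormedType.Exports.
Local Open Scope classical_set_scope.
Local Open Scope ring_scope.

(* The growth condition bounds the multiplication operators of the GNS
   representation of L, so that C = {x | forall y, L (x y^2) >= 0} is an
   archimedean cone; it is stable under products because x <= 1 is, in C and up
   to a remainder tending to 0, a sum of squares.  For b in A, the Hahn-Banach
   theorem splits L into two positive functionals, one for which b <= 0 and one
   for which b >= 0.  Splitting repeatedly along the elements a_i - q, q rational,
   produces a binary tree of functionals, whose normalizations converge along
   each branch to a character.  The masses L_s(1) of the nodes cut [0, 1[ into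
   nested intervals, so every point of [0, 1[ determines a branch, hence a
   character; the representing measure is the image of the Lebesgue measure.
   The map [0, 1[ -> X(A) is continuous off the countably many endpoints, which
   gives its measurability and the inner regularity of the image.

   Conversely, a representing measure vanishes off its compact support, where
   p = sum a_i^2 is bounded; and if p > t > v_L(p) on a neighbourhood U of a
   point of the support, then t^(2n) mu(U) <= L(p^(2n)) <= v_L(p)^(2n). *)

Set Implicit Arguments.
Unset Strict Implicit.
Unset Printing Implicit Defensive.

(** * Hahn-Banach theorem for sublinear functionals *)

Local Open Scope classical_set_scope.
Local Open Scope ring_scope.

Lemma le0_of_bounded_multiples (R : realType) (c B : R) :
  (forall n, n%:R * c <= B) -> c <= 0.
Proof.
move=> h; rewrite leNgt; apply/negP => c0.
have := h (Num.bound `|B / c|); rewrite leNgt => /negP; apply.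
by rewrite -ltr_pdivrMr// (le_lt_trans (ler_norm _))// archi_boundP.
Qed.

Section Sublinear.
Context {R : realType} {V : lmodType R}.

Definition sublinear (p : V -> R) :=
  (forall x y, p (x + y) <= p x + p y) /\
  (forall c x, 0 < c -> p (c *: x) = c * p x).

Lemma sublinear0 p : sublinear p -> p 0 = 0.
Proof. by case=> _ /(_ 2 0 ltac:(lra)); rewrite scaler0; lra. Qed.

Lemma sublinear_ge p x : sublinear p -> - p (- x) <= p x.
Proof.
by move=> sp; have := sp.1 x (- x); rewrite subrr sublinear0//; lra.
Qed.

(** Zorn's lemma for the reversed pointwise order. A chain is bounded by its pointwise infimum,
    which is finite because [- p (- x) <= - q (- x) <= q x] for every sublinear [q] below [p]. *)
Lemma minimal_sublinear p : sublinear p ->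
  exists q, [/\ sublinear q, forall x, q x <= p x &
    forall q', sublinear q' -> (forall x, q' x <= q x) -> q' = q].
Proof.
move=> sp.
pose T := {q : V -> R | sublinear q /\ forall x, q x <= p x}.
pose le (q q' : T) := `[< forall x, sval q' x <= sval q x >].
have le_id q : le q q by apply/asboolP.
have letr q1 q2 q3 : le q1 q2 -> le q2 q3 -> le q1 q3.
  by move=> /asboolP h1 /asboolP h2; apply/asboolP => x; exact: le_trans (h1 x).
have leanti q1 q2 : le q1 q2 -> le q2 q1 -> q1 = q2.
  case: q1 q2 => [q1 ?] [q2 ?] /asboolP/= h1 /asboolP/= h2; apply: eq_exist.
  by apply/funext => x; apply/eqP; rewrite eq_le h1 h2.
have chain (C : set T) : total_on C le -> exists t, forall s, C s -> le s t.
  move=> totC; have [[q0 Cq0]|/set0P/negP] := pselect (C !=set0); last first.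
    rewrite negbK => /eqP ->.
    by exists (exist _ p (conj sp (fun=> lexx _))).
  pose E x := [set sval q x | q in C].
  have E0 x : E x !=set0 by exists (sval q0 x), q0.
  have lbE x : lbound (E x) (- p (- x)).
    move=> _ [[q [sq qp]] _ <-] /=; apply: le_trans (sublinear_ge x sq).
    by rewrite lerN2.
  have infE q x : C q -> inf (E x) <= sval q x.
    by move=> Cq; apply: ge_inf; [exists (- p (- x))|exists q].
  have infP x r : (forall q, C q -> r <= sval q x) -> r <= inf (E x).
    by move=> h; apply: lb_le_inf => // _ [q Cq <-]; exact: h.
  have sinf : sublinear (fun x => inf (E x)).
    split=> [x y|c x c0].
      rewrite -lerBlDr; apply: (infP _ _) => q1 Cq1.
      rewrite lerBlDr -lerBlDl; apply: (infP _ _) => q2 Cq2; rewrite lerBlDl.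
      (* The chain is total, so the smaller of [q1] and [q2] lies below both. *)
      have [q [Cq qq1 qq2]] : exists q, [/\ C q, le q1 q & le q2 q].
        by case: (totC _ _ Cq1 Cq2) => h; [exists q2|exists q1]; split.
      apply: le_trans (infE q _ Cq) _.
      case: q Cq qq1 qq2 => q [[sq _] /= _] _ /asboolP/= h1 /asboolP/= h2.
      by apply: le_trans (sq _ _) _; apply: lerD.
    apply/eqP; rewrite eq_le; apply/andP; split.
      rewrite mulrC -ler_pdivrMr//; apply: (infP _ _) => q Cq.
      rewrite ler_pdivrMr// mulrC.
      by have := infE _ (c *: x) Cq; rewrite (proj2 (proj1 (svalP q))).
    apply: (infP _ _) => q Cq; rewrite (proj2 (proj1 (svalP q)))// ler_pM2l//.
    exact: infE.
  have infp x : inf (E x) <= p x.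
    by apply: le_trans (infE q0 x Cq0) _; exact: (proj2 (svalP q0)).
  exists (exist _ (fun x => inf (E x)) (conj sinf infp)) => s Cs.
  by apply/asboolP => x; exact: infE.
have [[q [sq qp]] qmax] := Zorn le_id letr leanti chain.
exists q; split=> // q' sq' q'q.
have q'p x : q' x <= p x by exact: le_trans (qp x).
have := qmax (exist _ q' (conj sq' q'p)).
by move=> /(_ (asboolT q'q)) [].
Qed.

(** A minimal sublinear [q] is linear. For fixed [x], the infimum over [t >= 0] of
    [q (z + t *: x) - t * q x] is sublinear in [z] and below [q], hence equal to [q z]; the term
    [t = 1] at [z = y] gives [q y <= q (y + x) - q x]. *)
Lemma sublinear_majorizes_linear p : sublinear p ->
  exists f : {scalar V}, forall x, f x <= p x.
Proof.
move=> /minimal_sublinear[q [sq qp qmin]].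
have qD x y : q (x + y) = q x + q y.
  apply/eqP; rewrite eq_le sq.1/=.
  pose E z := [set q (z + t *: x) - t * q x | t in [set t | 0 <= t]].
  have E0 z : E z !=set0 by exists (q (z + 0 *: x) - 0 * q x), 0 => //=.
  have lbE z : lbound (E z) (- q (- z)).
    move=> _ [t /= t0 <-]; rewrite lerBrDr.
    have -> : t * q x = q (t *: x).
      move: t0; rewrite le_eqVlt => /predU1P[<-|t0]; last by rewrite sq.2.
      by rewrite mul0r scale0r sublinear0.
    rewrite addrC lerBlDr; apply: le_trans (sq.1 _ _).
    by rewrite addrAC subrr add0r.
  have infE z t : 0 <= t -> inf (E z) <= q (z + t *: x) - t * q x.
    by move=> t0; apply: ge_inf; [exists (- q (- z))|exists t].
  have infP z r : (forall t, 0 <= t -> r <= q (z + t *: x) - t * q x) ->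
      r <= inf (E z).
    by move=> h; apply: lb_le_inf => // _ [t t0 <-]; exact: h.
  have sinf : sublinear (fun z => inf (E z)).
    split=> [z w|c z c0].
      rewrite -lerBlDr; apply: (infP _ _) => t t0.
      rewrite lerBlDr -lerBlDl; apply: (infP _ _) => u u0; rewrite lerBlDl.
      apply: le_trans (infE _ (t + u) _) _; first exact: addr_ge0.
      rewrite scalerDl addrACA; have := sq.1 (z + t *: x) (w + u *: x); lra.
    apply/eqP; rewrite eq_le; apply/andP; split.
      rewrite mulrC -ler_pdivrMr//; apply: (infP _ _) => t t0.
      rewrite ler_pdivrMr// mulrC.
      apply: le_trans (infE _ (c * t) _) _; first exact: mulr_ge0 (ltW c0) t0.
      by rewrite -scalerA -scalerDr sq.2// mulrBr mulrA.
    apply: (infP _ _) => t t0.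
    rewrite -(@ler_pM2l _ c^-1) ?invr_gt0// mulrA mulVf ?gt_eqF// mul1r.
    apply: le_trans (infE _ (c^-1 * t) _) _.
      by rewrite mulr_ge0// invr_ge0 ltW.
    rewrite mulrBr -[X in _ <= X - _]sq.2 ?invr_gt0// scalerDr !scalerA mulVf ?gt_eqF//.
    by rewrite scale1r mulrA.
  have infq z : inf (E z) <= q z.
    by have := infE z 0 (lexx _); rewrite scale0r addr0 mul0r subr0.
  have <- : inf (E y) = q y by have /(congr1 (@^~ y)) := qmin _ sinf infq.
  rewrite -lerBrDl.
  apply: le_trans (infE _ 1 ler01) _.
  by rewrite scale1r mul1r (addrC y).
have qN x : q (- x) = - q x.
  by apply/eqP; rewrite -addr_eq0 -qD addNr sublinear0.
have qZ c x : q (c *: x) = c * q x.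
  have [c0|c0|->] := ltgtP c 0; last by rewrite scale0r mul0r sublinear0.
    by rewrite -[c]opprK scaleNr qN sq.2 ?oppr_gt0// opprK mulNr opprK.
  exact: sq.2.
have qL : linear_for *%R q by move=> c x y; rewrite qD qZ.
pose q_linear := GRing.isLinear.Build R V R *%R q qL.
pose f : {scalar V} := HB.pack q q_linear.
by exists f.
Qed.

End Sublinear.

(** * The cone of a positive functional *)

Section Cone.
Context {R : realType} {A : comAlgType R}.
Implicit Types (W : {scalar A}) (x y z : A).

(** In the GNS representation of [W], multiplication by [x] is a positive operator. *)
Definition pos W x := forall y, 0 <= W (x * y ^+ 2).

(** Applied to [x] and [- x], this bounds every multiplication operator of the GNS
    representation. *)
Definition archimedean W := forall x, exists2 N : R, 0 < N & pos W (N%:A - x).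

Lemma scalarZ W (c : R) x : W (c *: x) = c * W x.
Proof. exact: linearZ. Qed.

Lemma scalarMA W (c : R) x : W (c%:A * x) = c * W x.
Proof. by rewrite mulr_algl scalarZ. Qed.

Lemma posD W x y : pos W x -> pos W y -> pos W (x + y).
Proof. by move=> px py z; rewrite mulrDl linearD addr_ge0. Qed.

Lemma posZ W c x : 0 <= c -> pos W x -> pos W (c *: x).
Proof. by move=> c0 px z; rewrite -scalerAl scalarZ mulr_ge0. Qed.

Lemma posMsq W x y : pos W x -> pos W (x * y ^+ 2).
Proof. by move=> px z; rewrite -mulrA -exprMn. Qed.

Lemma pos_ge0 W x : pos W x -> 0 <= W x.
Proof. by move/(_ 1); rewrite expr1n mulr1. Qed.

Lemma pos_sq W x : pos W 1 -> pos W (x ^+ 2).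
Proof. by rewrite -[x ^+ 2]mul1r; exact: posMsq. Qed.

Lemma posA W c : pos W 1 -> 0 <= c -> pos W c%:A.
Proof. by move=> p1 c0; exact: posZ. Qed.

Lemma pos0 W : pos W 0.
Proof. by move=> y; rewrite mul0r linear0. Qed.

Lemma pos_closed W x : (forall e : R, 0 < e -> pos W (x + e%:A)) -> pos W x.
Proof.
move=> h y; apply/ler_addgt0Pr => e e0.
have w0 : 0 <= `|W (y ^+ 2)| + 1 by rewrite addr_ge0.
have w1 : 0 < `|W (y ^+ 2)| + 1 by rewrite ltr_wpDl.
have := h (e / (`|W (y ^+ 2)| + 1)) (divr_gt0 e0 w1) y.
rewrite mulrDl linearD scalarMA => /le_trans; apply; rewrite lerD2l.
rewrite mulrAC ler_pdivrMr// ler_pM2l//.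
by apply: le_trans (ler_norm _) _; rewrite lerDl.
Qed.

(** The quadratic form [W (z * (t *: x + s *: y) ^+ 2)] in [t], [s] is nonnegative; two choices of
    [t], [s] give the discriminant inequality without any division. *)
Lemma cauchy_schwarz W z x y : pos W z ->
  W (z * x * y) ^+ 2 <= W (z * x ^+ 2) * W (z * y ^+ 2).
Proof.
move=> pz.
have q t s : 0 <= t ^+ 2 * W (z * x ^+ 2) + 2 * t * s * W (z * x * y)
    + s ^+ 2 * W (z * y ^+ 2).
  have := pz (t *: x + s *: y).
  have -> : z * (t *: x + s *: y) ^+ 2 = t ^+ 2 *: (z * x ^+ 2) +
      ((2 * t * s) *: (z * x * y) + s ^+ 2 *: (z * y ^+ 2)).
    have tE : t ^+ 2 *: (z * x ^+ 2) = t%:A * (t%:A * (z * x ^+ 2)).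
      by rewrite !mulr_algl scalerA.
    have sE : s ^+ 2 *: (z * y ^+ 2) = s%:A * (s%:A * (z * y ^+ 2)).
      by rewrite !mulr_algl scalerA.
    have tsE : (2 * t * s) *: (z * x * y) = 2 * (t%:A * (s%:A * (z * x * y))).
      by rewrite !mulr_algl scalerA -mulrA -scalerA scaler_nat mulr_natl.
    by rewrite tE sE tsE -(mulr_algl t x) -(mulr_algl s y); ring.
  by rewrite 2!linearD 3!scalarZ addrA.
have a0 := pz x; have c0 := pz y.
set a := W (z * x ^+ 2) in q a0 *; set c := W (z * y ^+ 2) in q c0 *.
set b := W _ in q *.
have [a1|a1] := eqVneq a 0.
  (* As [a = 0], the form takes the value [- ((c + 2) * b ^+ 2)] here, which forces
     [b ^+ 2 <= 0]. *)
  have := q (- (c + 1)) b.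
  have -> : (- (c + 1)) ^+ 2 * a + 2 * - (c + 1) * b * b + b ^+ 2 * c =
      - ((c + 2) * b ^+ 2) by rewrite a1; ring.
  by rewrite oppr_ge0 pmulr_rle0 ?ltr_wpDl// a1 mul0r.
have a2 : 0 < a by rewrite lt_neqAle eq_sym a1.
have := q b (- a).
have -> : b ^+ 2 * a + 2 * b * - a * b + (- a) ^+ 2 * c = a * (a * c - b ^+ 2).
  by ring.
by rewrite pmulr_rge0// subr_ge0.
Qed.

(* With u_0 = x and u_(k+1) = u_k - u_k^2, x = u_0^2 + ... + u_(n-1)^2 + u_n. *)
Lemma posM_le1 W x z : pos W 1 -> pos W x -> pos W (1 - x) -> pos W z ->
  pos W (x * z).
Proof.
move=> p1 px p1x pz y; rewrite leNgt; apply/negP; rewrite -oppr_gt0.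
set d := - _ => d0; pose u n := iter n (fun v => v - v ^+ 2) x.
have pu n : pos W (u n) /\ pos W (1 - u n).
  elim: n => [//|n [pn p1n]] /=; rewrite -/(u n); split.
    have -> : u n - u n ^+ 2 = u n * (1 - u n) ^+ 2 + (1 - u n) * u n ^+ 2.
      by ring.
    by apply: posD; exact: posMsq.
  have -> : 1 - (u n - u n ^+ 2) = (1 - u n) + u n ^+ 2 by ring.
  by apply: posD => //; exact: pos_sq.
pose G := W ((z * y) ^+ 2).
have G0 : 0 <= G by have := p1 (z * y); rewrite mul1r.
(* Subtracting [z * (u n * y) ^+ 2] keeps the first value below [- d]. By Cauchy-Schwarz each square
   [(u n * y) ^+ 2] then contributes at least [d ^+ 2 / G], and these contributions telescope. *)
have main n : W (u n * z * y ^+ 2) <= - d /\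
    n%:R * d ^+ 2 <= G * (W (x * y ^+ 2) - W (u n * y ^+ 2)).
  elim: n => [|n [IH1 IH2]]; first by rewrite mul0r subrr mulr0 opprK.
  rewrite /= -/(u n); split.
    have -> : (u n - u n ^+ 2) * z * y ^+ 2 =
      u n * z * y ^+ 2 - z * (u n * y) ^+ 2 by ring.
    by rewrite linearB; have := pz (u n * y); move: IH1; lra.
  have -> : (u n - u n ^+ 2) * y ^+ 2 = u n * y ^+ 2 - 1 * (u n * y) ^+ 2.
    by ring.
  have := cauchy_schwarz (u n * y) (z * y) p1.
  have -> : 1 * (u n * y) * (z * y) = u n * z * y ^+ 2 by ring.
  rewrite (mul1r ((z * y) ^+ 2)) -/G linearB.
  move: IH1 IH2; set a := W _; set b := W _; set e := W _; set f := W _.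
  move=> ad IH CS; rewrite -natr1.
  have : d ^+ 2 <= a ^+ 2.
    by rewrite -(sqrrN a) ler_pXn2r ?nnegrE//; lra.
  lra.
have : d ^+ 2 <= 0.
  apply: (@le0_of_bounded_multiples _ _ (G * W (x * y ^+ 2))) => n.
  apply: le_trans (main n).2 _; apply: ler_wpM2l => //.
  by rewrite gerBl; exact: (pu n).1.
by rewrite leNgt exprn_gt0.
Qed.

(** Dividing [x] by an archimedean bound [N] brings it below 1, where [posM_le1] applies. *)
Lemma posM W x z : pos W 1 -> archimedean W -> pos W x -> pos W z ->
  pos W (x * z).
Proof.
move=> p1 aW px pz; have [N N0 pN] := aW x.
have -> : x * z = N *: (N^-1 *: x * z).
  by rewrite -scalerAl scalerA mulfV ?gt_eqF// scale1r.
apply: posZ; first exact: ltW.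
have N1 : 0 <= N^-1 by rewrite invr_ge0 ltW.
apply: posM_le1 => //; first exact: posZ.
have -> : 1 - N^-1 *: x = N^-1 *: (N%:A - x).
  by rewrite scalerBr scalerA mulVf ?gt_eqF// scale1r.
exact: posZ.
Qed.

Lemma posX W x n : pos W 1 -> archimedean W -> pos W x -> pos W (x ^+ n).
Proof.
by move=> p1 aW px; elim: n => // n IH; rewrite exprS; exact: posM.
Qed.

Lemma half_double x : 2^-1 *: (x *+ 2) = x.
Proof. by rewrite -(scaler_nat _ x) scalerA mulVf ?pnatr_eq0// scale1r. Qed.

Lemma scaler_alg (c e : R) : c *: (e%:A : A) = (c * e)%:A.
Proof. by rewrite scalerA. Qed.

(* In the GNS representation q is nonnegative on the range of the positive
   operator t, which is invertible because q t >= c; without operators, the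
   factor u = 1 - t/N is iterated instead. *)
Lemma pos_of_mul W q t (c : R) : pos W 1 -> archimedean W -> 0 < c ->
  pos W t -> pos W (q * t - c%:A) -> pos W q.
Proof.
move=> p1 aW c0 pt pqt y; have [N N0 pN] := aW t.
have [M M0 pM] := aW (- q).
have N1 : 0 < N^-1 by rewrite invr_gt0.
pose t' := N^-1 *: t; pose c' := N^-1 * c; pose u := 1 - t'.
have pu : pos W u.
  have -> : u = N^-1 *: (N%:A - t).
    by rewrite scalerBr scalerA mulVf ?gt_eqF// scale1r.
  by apply: posZ => //; exact: ltW.
have pt' : pos W t' by apply: posZ => //; exact: ltW.
have pqt' : pos W (q * t' - c'%:A).
  have -> : q * t' - c'%:A = N^-1 *: (q * t - c%:A).
    by rewrite scalerBr scaler_alg -scalerAr.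
  by apply: posZ => //; exact: ltW.
have c'0 : 0 < c' by rewrite mulr_gt0.
(* The bound [q * t' >= c'] makes [f] lose at least [c' * w n] at each step, while [q >= - M] keeps
   [f n >= - (M * w n)]. *)
pose f n := W (q * u ^+ n * y ^+ 2); pose w n := W (u ^+ n * y ^+ 2).
have uS n : u ^+ n.+1 = u ^+ n - t' * u ^+ n by rewrite exprS mulrBl mul1r.
have w_ge0 n : 0 <= w n by exact: (posX _ p1 aW pu).
have f_dec n : f n.+1 <= f n - c' * w n.
  have := posM p1 aW pqt' (posX n p1 aW pu) y.
  have -> : (q * t' - c'%:A) * u ^+ n * y ^+ 2 =
    q * u ^+ n * y ^+ 2 - q * u ^+ n.+1 * y ^+ 2 - c'%:A * (u ^+ n * y ^+ 2).
    by rewrite uS; ring.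
  by rewrite !linearB scalarMA -/(f n) -/(f n.+1) -/(w n) /=; lra.
have w_dec n : w n.+1 <= w n.
  have := posM p1 aW pt' (posX n p1 aW pu) y.
  have -> : t' * u ^+ n * y ^+ 2 = u ^+ n * y ^+ 2 - u ^+ n.+1 * y ^+ 2.
    by rewrite uS; ring.
  by rewrite linearB -/(w n) -/(w n.+1) subr_ge0.
have f_lb n : - (M * w n) <= f n.
  have := posM p1 aW pM (posX n p1 aW pu) y.
  have -> : (M%:A - - q) * u ^+ n * y ^+ 2 =
    M%:A * (u ^+ n * y ^+ 2) + q * u ^+ n * y ^+ 2 by ring.
  by rewrite linearD scalarMA -/(w n) -/(f n); lra.
rewrite leNgt; apply/negP => f0.
have {}f0 : f 0%N < 0 by rewrite /f expr0 mulr1.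
have w_le n : w n <= w 0%N.
  by elim: n => // n; apply: le_trans (w_dec n).
have fn n : f n <= f 0%N.
  elim: n => // n; apply: le_trans; apply: le_trans (f_dec n) _.
  by rewrite gerBl mulr_ge0// ltW.
(* From [- (M * w n) <= f n <= f 0] follows [w n >= - f 0 / M], so every step lowers [f] by at least
   [e > 0], although [f n >= - (M * w 0)]. *)
pose e := c' * (- f 0%N / M).
have fne n : f n <= - (n%:R * e).
  elim: n => [|n IH]; first by rewrite mul0r oppr0 ltW.
  apply: le_trans (f_dec n) _; rewrite -natr1 mulrDl mul1r opprD.
  apply: lerD => //; rewrite lerN2 /e ler_pM2l// ler_pdivrMr//.
  by have := f_lb n; have := fn n; rewrite mulrC; lra.
have : e <= 0.
  apply: (@le0_of_bounded_multiples _ _ (M * w 0%N)) => n.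
  have := fne n; have := f_lb n.
  have : M * w n <= M * w 0%N by rewrite ler_pM2l.
  lra.
by rewrite leNgt /e mulr_gt0// divr_gt0// oppr_gt0.
Qed.

(* For w = s - b t = s' + b t', w (s + s') = w^2 + s s' + b^2 t t', so w + e
   times the positive element s + s' + e is bounded below. *)
Lemma pos_cap W b s t s' t' : pos W 1 -> archimedean W ->
  pos W s -> pos W t -> pos W s' -> pos W t' ->
  s - b * t = s' + b * t' -> pos W (s - b * t).
Proof.
move=> p1 aW ps pt ps' pt' E; apply: pos_closed => e e0.
set w := s - b * t.
(* Completing the square explains the constant: [w^2 + e w + e^2 = (w + e/2)^2 + (3/4) e^2]. *)
apply: (@pos_of_mul W _ (s + s' + e%:A) (3 / 4 * e ^+ 2)) => //.
- by apply: mulr_gt0; [lra|exact: exprn_gt0].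
- by apply: posD; [exact: posD|apply: posA => //; exact: ltW].
have -> : (3 / 4 * e ^+ 2)%:A = e%:A ^+ 2 - ((2^-1 * e)%:A) ^+ 2 :> A.
  have sq c : c%:A ^+ 2 = (c ^+ 2)%:A :> A by rewrite expr2 mulr_algl scaler_alg.
  by rewrite !sq -scalerBl; congr (_ *: _); field.
have -> : (w + e%:A) * (s + s' + e%:A) - (e%:A ^+ 2 - (2^-1 * e)%:A ^+ 2) =
   (w + (2^-1 * e)%:A) ^+ 2 + (s * s' + t * t' * b ^+ 2 + e%:A * (s + s')).
  have e2 : e%:A = (2^-1 * e)%:A + (2^-1 * e)%:A :> A.
    by rewrite -scalerDl; congr (_ *: _); lra.
  have -> : t * t' * b ^+ 2 = (b * t) * (b * t') by ring.
  have -> : b * t' = s - b * t - s' by rewrite E; ring.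
  by rewrite e2 /w; ring.
apply: posD; first exact: pos_sq.
apply: posD; first apply: posD; first exact: posM.
  by apply: posMsq; exact: posM.
by rewrite mulr_algl; apply: posZ; [exact: ltW|exact: posD].
Qed.

End Cone.

(** * Splitting functionals *)

Section Split.
Context {R : realType} {A : comAlgType R}.
Implicit Types (W : {scalar A}) (x y z b : A).

(** These are the elements certified to be nonnegative where [b >= 0]. *)
Definition cone W b : set A :=
  [set z | exists s t, [/\ pos W s, pos W t & z = s + b * t]].

Lemma coneD W b x y : cone W b x -> cone W b y -> cone W b (x + y).
Proof.
move=> [s [t [ps pt ->]]] [s' [t' [ps' pt' ->]]].
by exists (s + s'), (t + t'); split; [exact: posD|exact: posD|ring].
Qed.

Lemma coneZ W b c x : 0 <= c -> cone W b x -> cone W b (c *: x).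
Proof.
move=> c0 [s [t [ps pt ->]]].
exists (c *: s), (c *: t); split; [exact: posZ|exact: posZ|].
by rewrite scalerDr scalerAr.
Qed.

Lemma pos_cone W b x : pos W x -> cone W b x.
Proof.
by exists x, 0; split=> //; [exact: pos0|rewrite mulr0 addr0].
Qed.

Lemma cone_mul W b x : pos W x -> cone W b (b * x).
Proof. by exists 0, x; split=> //; [exact: pos0|rewrite add0r]. Qed.

(* W0 is dominated by the sublinear functional
   x |-> inf {W z | z - x >= 0 where b <= 0, and z >= 0 where b >= 0}. *)
Lemma functional_split W b : pos W 1 -> archimedean W ->
  exists W0 W1 : {scalar A}, [/\ forall x, W x = W0 x + W1 x,
    forall x, pos W x -> pos W0 x, forall x, pos W x -> pos W1 x,
    pos W0 (- b) & pos W1 b].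
Proof.
move=> p1 aW.
(* An element nonnegative both where [b <= 0] and where [b >= 0] has [W z >= 0]; this keeps the
   infimum [p] finite. *)
have capP z : cone W (- b) z -> cone W b z -> 0 <= W z.
  move=> [s [t [ps pt ->]]] [s' [t' [ps' pt']]]; rewrite mulNr => E.
  by apply: pos_ge0; exact: (pos_cap p1 aW ps pt ps' pt' E).
pose Z x := [set z | cone W (- b) (z - x) /\ cone W b z].
pose p x := inf [set W z | z in Z x].
have Z0 x : Z x !=set0.
  have [N N0 pN] := aW x.
  by exists N%:A; split; apply: pos_cone => //; apply: posA => //; exact: ltW.
have lbZ x : exists r, lbound [set W z | z in Z x] r.
  have [N N0 pN] := aW (- x).
  exists (- W N%:A) => _ [z [z1 z2] <-]; rewrite lerNl -subr_ge0 opprK.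
  rewrite addrC -linearD; apply: capP.
    have -> : z + N%:A = (z - x) + (N%:A - - x) by ring.
    by apply: coneD => //; exact: pos_cone.
  apply: coneD => //; apply: pos_cone; apply: posA => //; exact: ltW.
have le_p x z : Z x z -> p x <= W z.
  by move=> xz; apply: ge_inf; [exact: lbZ|exists z].
have p_le x r : (forall z, Z x z -> r <= W z) -> r <= p x.
  move=> h; apply: lb_le_inf; last by move=> _ [z xz <-]; exact: h.
  by have [z xz] := Z0 x; exists (W z), z.
have p_scale c x : 0 < c -> p (c *: x) <= c * p x.
  move=> c0; rewrite mulrC -ler_pdivrMr//; apply: (p_le _ _) => z [z1 z2].
  rewrite ler_pdivrMr// mulrC -scalarZ; apply: le_p; split.
    by rewrite -scalerBr; exact: coneZ (ltW c0) z1.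
  exact: coneZ (ltW c0) z2.
have sp : sublinear p.
  split=> [x y|c x c0].
    rewrite -lerBlDr; apply: (p_le _ _) => z1 [z11 z12].
    rewrite lerBlDr -lerBlDl; apply: (p_le _ _) => z2 [z21 z22].
    rewrite lerBlDl -linearD; apply: le_p; split; last exact: coneD.
    have -> : z1 + z2 - (x + y) = (z1 - x) + (z2 - y) by ring.
    exact: coneD.
  apply/eqP; rewrite eq_le p_scale//=.
  rewrite -ler_pdivlMl//; apply: le_trans (p_scale _ _ _); last first.
    by rewrite invr_gt0.
  by rewrite scalerA mulVf ?gt_eqF// scale1r.
have [W0 W0p] := sublinear_majorizes_linear sp.
pose w1 x := W x - W0 x.
have w1L : linear_for *%R w1.
  by move=> c x y; rewrite /w1 (linearD W) (linearD W0) !scalarZ; ring.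
pose w1_linear := GRing.isLinear.Build R A R *%R w1 w1L.
pose W1 : {scalar A} := HB.pack w1 w1_linear.
(* The element [z = 0] competes in the infimum that defines [p (- g)]. *)
have W0_ge0 g : cone W (- b) g -> 0 <= W0 g.
  move=> cg; rewrite -[g]opprK linearN oppr_ge0.
  apply: le_trans (W0p _) _; rewrite -(linear0 W); apply: le_p; split.
    by rewrite opprK add0r.
  by apply: pos_cone; exact: pos0.
(* The element [z = g] competes in the infimum that defines [p g], so [W0 g <= W g]. *)
have W1_ge0 g : cone W b g -> 0 <= W1 g.
  move=> cg; rewrite subr_ge0; apply: le_trans (W0p _) _.
  apply: le_p; split => //; rewrite subrr; apply: pos_cone; exact: pos0.
exists W0, W1; split.
- by move=> x; rewrite /= /w1; ring.
- by move=> x px y; apply: W0_ge0; apply: pos_cone; exact: posMsq.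
- by move=> x px y; apply: W1_ge0; apply: pos_cone; exact: posMsq.
- by move=> y; apply: W0_ge0; apply: cone_mul; exact: pos_sq.
- by move=> y; apply: W1_ge0; apply: cone_mul; exact: pos_sq.
Qed.

End Split.

(** * Approximation of elements by scalars in the order of the cone *)

Section Near.
Context {R : realType} {A : comAlgType R}.
Implicit Types (W : {scalar A}) (x y z b : A).

Definition approx W x r e := pos W (e%:A - (x - r%:A)) /\ pos W (e%:A + (x - r%:A)).

Lemma approx_le W x r e : approx W x r e -> `|W x - r * W 1| <= e * W 1.
Proof.
move=> [/pos_ge0 + /pos_ge0]; rewrite !(linearD, linearN) !scalarZ/=.
by rewrite ler_norml; lra.
Qed.

Lemma approx_cst W r e : pos W 1 -> 0 <= e -> approx W r%:A r e.
Proof. by move=> p1 e0; split; rewrite subrr ?subr0 ?addr0; exact: posA. Qed.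

Lemma approxD W x y r s e f : approx W x r e -> approx W y s f ->
  approx W (x + y) (r + s) (e + f).
Proof.
move=> [x1 x2] [y1 y2]; split.
  have -> : (e + f)%:A - (x + y - (r + s)%:A) =
    (e%:A - (x - r%:A)) + (f%:A - (y - s%:A)) by rewrite !scalerDl; ring.
  exact: posD.
have -> : (e + f)%:A + (x + y - (r + s)%:A) =
  (e%:A + (x - r%:A)) + (f%:A + (y - s%:A)) by rewrite !scalerDl; ring.
exact: posD.
Qed.

Lemma approxZ W x c r e : approx W x r e -> approx W (c *: x) (c * r) (`|c| * e).
Proof.
have E : c *: x - (c * r)%:A = c *: (x - r%:A) by rewrite scalerBr scaler_alg.
move=> [x1 x2]; rewrite /approx E -scaler_alg; have [c0|c0] := leP 0 c.
  by rewrite ger0_norm// -scalerBr -scalerDr; split; exact: posZ.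
rewrite ltr0_norm//.
rewrite -[c *: _]opprK -scaleNr -scalerBr opprK -scalerDr.
by split; apply: posZ => //; rewrite oppr_ge0 ltW.
Qed.

(** For the deviations [u], [v] one has [2 (e f - u v) = (e + u) (f - v) + (e - u) (f + v)], a sum
    of products of positive elements, and similarly for [e f + u v]. Then
    [x y = u v + r v + s u + r s]. *)
Lemma approxM W x y r s e f : pos W 1 -> archimedean W ->
  approx W x r e -> approx W y s f ->
  approx W (x * y) (r * s) (e * f + `|r| * f + `|s| * e).
Proof.
move=> p1 aW [x1 x2] [y1 y2].
set u := x - _ in x1 x2; set v := y - _ in y1 y2.
have half : (e * f)%:A = e%:A * f%:A :> A by rewrite mulr_algl scaler_alg.
have uv : approx W (u * v) 0 (e * f).
  rewrite /approx half scale0r subr0; split.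
    have -> : e%:A * f%:A - u * v = 2^-1 *:
        ((e%:A + u) * (f%:A - v) + (e%:A - u) * (f%:A + v)).
      have -> : (e%:A + u) * (f%:A - v) + (e%:A - u) * (f%:A + v) =
        (e%:A * f%:A - u * v) *+ 2 by ring.
      by rewrite half_double.
    by apply: posZ; [lra|apply: posD; exact: posM].
  have -> : e%:A * f%:A + u * v = 2^-1 *:
      ((e%:A + u) * (f%:A + v) + (e%:A - u) * (f%:A - v)).
    have -> : (e%:A + u) * (f%:A + v) + (e%:A - u) * (f%:A - v) =
      (e%:A * f%:A + u * v) *+ 2 by ring.
    by rewrite half_double.
  by apply: posZ; [lra|apply: posD; exact: posM].
have u0 : approx W u 0 e by rewrite /approx scale0r subr0.
have v0 : approx W v 0 f by rewrite /approx scale0r subr0.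
have := approxD uv (approxD (approxZ r v0) (approxD (approxZ s u0)
  (@approx_cst W (r * s) 0 p1 (lexx _)))).
rewrite !mulr0 !add0r addr0 -addrA.
have -> : (r * s)%:A = r%:A * s%:A :> A by rewrite mulr_algl scaler_alg.
by congr approx; rewrite -(mulr_algl r v) -(mulr_algl s u) /u /v; ring.
Qed.

End Near.

Lemma discrete_crossing (P Q : nat -> Prop) n : P 0%N -> Q n.+1 ->
  (forall k, (k <= n)%N -> P k \/ Q k) ->
  exists k, [/\ (k <= n)%N, P k & Q k.+1].
Proof.
elim: n => [|n IH] P0 Qn PQ; first by exists 0%N.
case: (PQ n.+1 (leqnn _)) => [Pn|Qn1]; first by exists n.+1.
have [|k [kn Pk Qk]] := IH P0 Qn1.
  by move=> k kn; apply: PQ; exact: leqW.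
by exists k; split=> //; exact: leqW.
Qed.

(** * The binary tree of functionals *)

Section Tree.
Context {R : realType} {A : comAlgType R} {m : nat}.
Variables (L : {scalar A}) (a : 'I_m -> A).
Hypotheses (L1 : pos L 1) (aL : archimedean L) (ha : generates a).

Definition threshold (N k M : nat) : R := k%:R / M.+1%:R - N%:R.

(** Enumerates the elements [a i - q], with [q] on the grid of mesh [1 / M.+1] that starts at [- N].
    A number that encodes no quadruple cuts along 0, so every level of the tree is defined. *)
Definition cut (n : nat) : A :=
  if (unpickle n : option ('I_m * nat * nat * nat)) is Some (i, N, k, M)
  then a i - (threshold N k M)%:A else 0.

(** The hypotheses on [W] stand under the existential, so that choice gives a total function and
    [node] is a plain recursion. *)
Lemma halves_ex (W : {scalar A}) (b : A) : exists W' : bool -> {scalar A},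
  pos W 1 -> archimedean W ->
  [/\ forall x, W x = W' false x + W' true x,
      forall c x, pos W x -> pos (W' c) x,
      pos (W' false) (- b) & pos (W' true) b].
Proof.
have [[p1 aW]|h] := pselect (pos W 1 /\ archimedean W); last first.
  by exists (fun=> W) => p1 aW; exfalso; apply: h.
have [W0 [W1 [WE W0p W1p W0b W1b]]] := functional_split b p1 aW.
exists (fun c => if c then W1 else W0) => _ _; split => //.
by move=> [].
Qed.

Definition halves W b := projT1 (cid (halves_ex W b)).

(* The head of [s] is the most recent choice. *)
Fixpoint node (s : seq bool) : {scalar A} :=
  if s is c :: s' then halves (node s') (cut (size s')) c else L.

Lemma node_good s : pos (node s) 1 /\ archimedean (node s).
Proof.
elim: s => [//|c s [p1 aW]] /=; rewrite /halves.
case: cid => W' /= /(_ p1 aW)[_ W'p _ _]; split; first exact: W'p.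
by move=> x; have [N N0 pN] := aW x; exists N => //; exact: W'p.
Qed.

Let node1 s := (node_good s).1.
Let nodeA s := (node_good s).2.

Lemma node_split s x : node s x = node (false :: s) x + node (true :: s) x.
Proof.
by rewrite /= /halves; case: cid => W' /= /(_ (node1 s) (nodeA s))[].
Qed.

Lemma node_cat t s x : pos (node s) x -> pos (node (t ++ s)) x.
Proof.
move=> ps; elim: t => //= c t IH; rewrite /halves.
by case: cid => W' /= /(_ (node1 _) (nodeA _))[_ + _ _]; exact.
Qed.

Lemma node_cut s j : (j < size s)%N ->
  pos (node s) (cut j) \/ pos (node s) (- cut j).
Proof.
elim: s => // c s IH; rewrite /= ltnS leq_eqVlt => /predU1P[->|/IH js].
  rewrite /halves; case: cid => W' /= /(_ (node1 _) (nodeA _))[_ _ h0 h1].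
  by case: c; [left|right].
by case: js => h; [left|right]; exact: (@node_cat [:: c]).
Qed.

(** The depth [n] serves all nodes at once. The bound [N] does not depend on [e], since it controls
    the factors [r] in the error term of [approxM]. *)
Definition localized (x : A) := exists N : R, forall e : R, 0 < e ->
  exists n, forall s, (n <= size s)%N ->
    exists r, `|r| <= N /\ approx (node s) x r e.

Lemma approx_weaken (W : {scalar A}) x r (e f : R) : pos W 1 -> e <= f ->
  approx W x r e -> approx W x r f.
Proof.
move=> p1 ef.
have fe : 0 <= f - e by rewrite subr_ge0.
move=> /approxD /(_ (@approx_cst _ _ W 0 (f - e) p1 fe)).
by rewrite scale0r !addr0 addrC subrK.
Qed.

Lemma archimedean_bound x : exists N : nat, pos L (N%:R%:A - x) /\ pos L (N%:R%:A + x).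
Proof.
have [N1 N10 p1] := aL x; have [N2 N20 p2] := aL (- x).
pose N := Num.bound (`|N1| + `|N2|).
have NP : `|N1| + `|N2| < N%:R by apply: archi_boundP; rewrite addr_ge0.
have := ler_norm N1; have := ler_norm N2.
have := normr_ge0 N1; have := normr_ge0 N2 => n2 n1 le2 le1.
exists N; split.
  have -> : N%:R%:A - x = (N%:R - N1)%:A + (N1%:A - x) by rewrite scalerBl; ring.
  by apply: posD => //; apply: posA => //; lra.
have -> : N%:R%:A + x = (N%:R - N2)%:A + (N2%:A - - x) by rewrite scalerBl; ring.
by apply: posD => //; apply: posA => //; lra.
Qed.

(** Deep enough nodes decide the sign of [a i - q] for every [q] on a fine grid of [[- N, N]]. The
    sign is known at both ends, hence changes between two neighbouring grid points. *)
Lemma localized_gen i : localized (a i).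
Proof.
have [N0 [pN1 pN2]] := archimedean_bound (a i).
(* A positive [N] makes the number [2 * N * M.+1] of grid steps nonzero, so that it is the successor
   of [B]. *)
pose N := N0.+1.
have {}pN1 : pos L (N%:R%:A - a i).
  have -> : N%:R%:A - a i = 1%:A + (N0%:R%:A - a i).
    by rewrite /N -natr1 scalerDl; ring.
  by apply: posD => //; apply: posA => //; lra.
have {}pN2 : pos L (N%:R%:A + a i).
  have -> : N%:R%:A + a i = 1%:A + (N0%:R%:A + a i).
    by rewrite /N -natr1 scalerDl; ring.
  by apply: posD => //; apply: posA => //; lra.
exists N%:R => e e0.
pose M := Num.bound e^-1.
have M0 : 0 < M.+1%:R :> R by rewrite ltr0n.
have eM : M.+1%:R^-1 <= e.
  rewrite -[e]invrK lef_pV2 ?posrE ?invr_gt0//.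
  have : e^-1 < M%:R by apply: archi_boundP; rewrite invr_ge0 ltW.
  by move=> /ltW/le_trans; apply; rewrite ler_nat.
pose B := (2 * N * M.+1).-1.
have BE : B.+1 = (2 * N * M.+1)%N by rewrite /B prednK// !muln_gt0.
have thr0 : threshold N 0 M = - N%:R by rewrite /threshold mul0r add0r.
have thrB : threshold N B.+1 M = N%:R.
  rewrite /threshold BE !natrM mulfK ?gt_eqF//; lra.
have thrS k : threshold N k.+1 M = threshold N k M + M.+1%:R^-1.
  by rewrite /threshold -natr1 mulrDl mul1r addrAC.
pose n := (\max_(k < B.+1) pickle (i, N, val k, M)).+1.
exists n => s ns.
have [] := @discrete_crossing (fun k => pos (node s) (a i - (threshold N k M)%:A))
  (fun k => pos (node s) ((threshold N k M)%:A - a i)) B.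
- rewrite thr0 scaleNr opprK addrC -[s]cats0; exact: node_cat.
- rewrite thrB -[s]cats0; exact: node_cat.
- move=> k kB; have : (pickle (i, N, k, M) < size s)%N.
    apply: leq_trans ns; rewrite ltnS.
    have kB1 : (k < B.+1)%N by rewrite ltnS.
    exact: (@leq_bigmax _ (fun k : 'I_B.+1 => pickle (i, N, val k, M)) (Ordinal kB1)).
  by move=> /node_cut; rewrite /cut pickleK opprB.
move=> k [kB k1 k2]; exists (threshold N k M); split.
  have h1 : 0 <= k%:R / M.+1%:R :> R by rewrite divr_ge0.
  have h2 : k%:R / M.+1%:R <= B.+1%:R / M.+1%:R :> R.
    by rewrite ler_pM2r ?invr_gt0// ler_nat leqW.
  move: h1 h2 thrB; rewrite /threshold ler_norml.
  by move: (k%:R / _) (B.+1%:R / _) => x1 x2 *; lra.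
split.
  have -> : e%:A - (a i - (threshold N k M)%:A) =
     (e - M.+1%:R^-1)%:A + ((threshold N k.+1 M)%:A - a i).
    by rewrite thrS (scalerBl e) (@scalerDl _ _ _ (threshold _ _ _)); ring.
  by apply: posD => //; apply: posA; rewrite ?subr_ge0.
by apply: posD => //; apply: posA => //; exact: ltW.
Qed.

(** The localized elements form a subalgebra that contains the generators. *)
Lemma localized_all x : localized x.
Proof.
pose S : {pred A} := fun x => `[< localized x >].
suff subS : subalg_closed S.
  by have /asboolP := ha subS (fun i => asboolT (localized_gen i)) x.
have SE y : (y \in S) = `[< localized y >] by [].
split=> [|c u v|u v]; rewrite !SE.
- apply/asboolP; exists 1 => e e0; exists 0%N => s _; exists 1.
  by rewrite normr1 lexx; split=> //; rewrite -[X in approx _ X]scale1r;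
    apply: approx_cst => //; exact: ltW.
- move=> /asboolP[N hN] /asboolP[N' hN']; apply/asboolP.
  exists (`|c| * N + N') => e e0.
  have d0 : 0 < e / (`|c| + 1) by rewrite divr_gt0// ltr_wpDl.
  have [n hn] := hN _ d0; have [n' hn'] := hN' _ d0.
  exists (maxn n n') => s; rewrite geq_max => /andP[/hn[r [rN nr]] /hn'[r' [rN' nr']]].
  exists (c * r + r'); split.
    apply: le_trans (ler_normD _ _) _; rewrite normrM lerD// ler_wpM2l//.
  apply: approx_weaken (approxD (approxZ c nr) nr') => //.
  have c1 : 0 < `|c| + 1 by rewrite ltr_wpDl.
  by rewrite -[X in _ + X]mul1r -mulrDl mulrC divfK// gt_eqF.
move=> /asboolP[N hN] /asboolP[N' hN']; apply/asboolP.
exists (`|N| * `|N'|) => e e0.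
pose K := 1 + `|N| + `|N'|.
have K1 : 1 <= K by rewrite /K -addrA lerDl addr_ge0.
have K0 : 0 < K by exact: lt_le_trans K1.
(* With [d <= 1] the error [d * d + |r| * d + |r'| * d] of the product is at most [d * K <= e]. *)
pose d := Num.min 1 (e / K).
have d0 : 0 < d by rewrite lt_min ltr01 divr_gt0.
have [n hn] := hN _ d0; have [n' hn'] := hN' _ d0.
exists (maxn n n') => s; rewrite geq_max => /andP[/hn[r [rN nr]] /hn'[r' [rN' nr']]].
have {}rN : `|r| <= `|N| by apply: le_trans rN (ler_norm _).
have {}rN' : `|r'| <= `|N'| by apply: le_trans rN' (ler_norm _).
exists (r * r'); split; first by rewrite normrM ler_pM.
apply: approx_weaken (approxM (node1 s) (nodeA s) nr nr') => //.
have dK : d * K <= e by rewrite -ler_pdivlMr// ge_min lexx orbT.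
apply: le_trans dK; rewrite /K !mulrDr mulr1 lerD//; first (rewrite lerD//).
- by rewrite ger_pMl// ge_min lexx.
- by rewrite mulrC ler_pM2l.
- by rewrite mulrC ler_pM2l.
Qed.

End Tree.

(** * Branches of the tree *)

Lemma eq_of_dist_le (R : realType) (K x y : R) :
  (forall e, 0 < e -> e <= 1 -> `|x - y| <= e * K) -> x = y.
Proof.
move=> h; apply/eqP; rewrite -subr_eq0 -normr_le0.
apply: (@le0_of_bounded_multiples _ _ K) => n.
have [->|n0] := posnP n.
  by rewrite mul0r -[leRHS]mul1r; apply: le_trans (h 1 _ _).
rewrite -ler_pdivlMl ?ltr0n//; apply: h; first by rewrite invr_gt0 ltr0n.
by rewrite invf_le1 ?ltr0n// ler1n.
Qed.

Lemma ex_character (R : realType) (A : comAlgType R) (h : A -> R) :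
  linear_for *%R h -> {morph h : x y / x * y} -> h 1 = 1 ->
  exists alpha : character A, forall x, alpha x = h x.
Proof.
move=> hL hM h1.
pose h_linear := GRing.isLinear.Build R A R *%R h hL.
pose h_monoid := GRing.isMonoidMorphism.Build A R h (h1, hM).
pose alpha : {lrmorphism A -> R | *%R} := HB.pack h h_linear h_monoid.
by exists alpha.
Qed.

Section Branch.
Context {R : realType} {A : comAlgType R} {m : nat}.
Variables (L : {scalar A}) (a : 'I_m -> A).
Hypotheses (L1 : L 1 = 1) (pL : pos L 1) (aL : archimedean L) (ha : generates a).

Notation node := (node L a).

Definition mass s : R := node s 1.

(** The interval of the [false] child comes first, and that of the [true] child starts where it
    ends. *)
Fixpoint left_end (s : seq bool) : R :=
  if s is c :: s' then left_end s' + (if c then mass (false :: s') else 0) else 0.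

Definition cell s : set R := [set x | left_end s <= x < left_end s + mass s].

Fixpoint branch (x : R) (n : nat) : seq bool :=
  if n is n'.+1 then let s := branch x n' in
    (left_end s + mass (false :: s) <= x) :: s else [::].

Let node1 s := (node_good a pL aL s).1.
Let nodeA s := (node_good a pL aL s).2.

Lemma mass_ge0 s : 0 <= mass s. Proof. exact: pos_ge0. Qed.

Lemma mass_split s : mass s = mass (false :: s) + mass (true :: s).
Proof. exact: node_split. Qed.

Lemma size_branch x n : size (branch x n) = n.
Proof. by elim: n => //= n ->. Qed.

Lemma branch_cat x n k : exists t, branch x (k + n) = t ++ branch x n.
Proof.
elim: k => [|k [t E]]; first by exists [::].
by rewrite addSn /= E; eexists (_ :: t).
Qed.

Lemma cell_split s : cell s = cell (false :: s) `|` cell (true :: s).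
Proof.
have := mass_split s; have := mass_ge0 (false :: s).
have := mass_ge0 (true :: s) => m1 m0 ms.
apply/seteqP; split=> [x /= /andP[x1 x2]|x /= []/= /andP[x1 x2]].
- have [h|h] := ltP x (left_end s + mass (false :: s)); [left|right].
    by rewrite /cell/= addr0 x1.
  by rewrite /cell/= h/= -addrA -ms.
- move: x1 x2; rewrite /cell/= addr0 => -> x2.
  by rewrite (lt_le_trans x2)// ms; lra.
- move: x1 x2; rewrite /cell/= => x1 x2.
  by rewrite (le_trans _ x1) ?lerDl//= ms addrA.
Qed.

Lemma cell_disj s : [disjoint cell (false :: s) & cell (true :: s)].
Proof.
apply/disj_setPS => x [/andP[_ x1] /andP[x2 _]].
by move: x1; rewrite /= addr0 ltNge x2.
Qed.

Lemma branch_cell x n : cell [::] x -> cell (branch x n) x.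
Proof.
move=> x0; elim: n => // n; rewrite cell_split /= -/(branch x n).
set s := branch x n.
case: (leP (left_end s + mass (false :: s)) x) => h [] //.
  by move=> /andP[_]; rewrite /= addr0 ltNge h.
by move=> /andP[]; rewrite leNgt h.
Qed.

Lemma cell_branch x s : cell s x -> branch x (size s) = s.
Proof.
elim: s => //= c s IH xs.
have xs' : cell s x by rewrite cell_split; case: c xs; [right|left].
rewrite IH//; congr (_ :: _); case: c xs => /andP[x1 x2]; first exact: x1.
by rewrite leNgt; move: x2; rewrite /= addr0 => ->.
Qed.

(** A half-open interval with a point in it has positive length, so the functionals along a branch
    can be normalized. *)
Lemma mass_branch x n : cell [::] x -> 0 < mass (branch x n).
Proof. by move=> /(@branch_cell _ n) /andP[h1 /(le_lt_trans h1)]; rewrite ltrDl. Qed.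

(** Characterizes [h] as the limit of the normalized functionals along the branch of [x], without
    forming their quotients. *)
Definition follows x (h : A -> R) := forall y n r e,
  approx (node (branch x n)) y r e -> `|h y - r| <= e.

Lemma approx_branch x n n' y r e : (n <= n')%N ->
  approx (node (branch x n)) y r e -> approx (node (branch x n')) y r e.
Proof.
move=> nn' [h1 h2]; have [t] := branch_cat x n (n' - n).
by rewrite subnK// => ->; split; exact: node_cat.
Qed.

Lemma ex_approx x y e : 0 < e -> exists n, forall n', (n <= n')%N ->
  exists r, approx (node (branch x n')) y r e.
Proof.
move=> e0; have [N /(_ e e0)[n hn]] := localized_all pL aL ha y.
exists n => n' nn'; have [|r [_ hr]] := hn (branch x n').
  by rewrite size_branch.
by exists r.
Qed.

(** Any two intervals [[r - e, r + e]] attached to [y] meet: both approximations hold at the deeper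
    node, whose mass is positive. The supremum of the left ends therefore lies in all of them. *)
Lemma ex_follows_fun x : cell [::] x -> exists h, follows x h.
Proof.
move=> x0.
pose E y := [set z | exists n r e, approx (node (branch x n)) y r e /\ z = r - e].
have cross y n r e n' r' e' : approx (node (branch x n)) y r e ->
    approx (node (branch x n')) y r' e' -> r - e <= r' + e'.
  move=> /(approx_branch (leq_maxl n n')) /approx_le h1.
  move=> /(approx_branch (leq_maxr n n')) /approx_le h2.
  set s := branch _ _ in h1 h2.
  have m0 : 0 < node s 1 by exact: mass_branch.
  rewrite -(ler_pM2r m0) mulrBl mulrDl.
  by move: h1 h2; rewrite !ler_norml => /andP[? ?] /andP[? ?]; lra.
have E0 y : E y !=set0.
  have [n /(_ n (leqnn n))[r nr]] := @ex_approx x y 1 ltr01.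
  by exists (r - 1), n, r, 1.
exists (fun y => sup (E y)) => y n r e nr.
have ub : ubound (E y) (r + e).
  by move=> _ [n' [r' [e' [nr' ->]]]]; exact: cross nr' nr.
rewrite ler_distl; apply/andP; split; last exact: ge_sup.
by apply: ub_le_sup; [exists (r + e)|exists n, r, e].
Qed.

(** At a common node the approximations add and multiply with errors proportional to [e], so the
    limit is linear and multiplicative. *)
Lemma ex_follows x : cell [::] x -> exists alpha : character A, follows x alpha.
Proof.
move=> x0; have [h hh] := ex_follows_fun x0.
have h2 y z e : 0 < e -> exists n r s, [/\ approx (node (branch x n)) y r e,
    approx (node (branch x n)) z s e, `|h y - r| <= e & `|h z - s| <= e].
  move=> e0; have [n hn] := ex_approx x y e0; have [n' hn'] := ex_approx x z e0.
  have [r nr] := hn _ (leq_maxl n n'); have [s ns] := hn' _ (leq_maxr n n').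
  by exists (maxn n n'), r, s; split=> //; [exact: hh nr|exact: hh ns].
have [|||alpha alphaE] := @ex_character _ _ h.
- move=> c y z; apply: (@eq_of_dist_le _ (2 * (`|c| + 1))) => e e0 _.
  have [n [r [s [nr ns hr hs]]]] := h2 y z e e0.
  have := hh _ _ _ _ (approxD (approxZ c nr) ns).
  have : `|c * (h y - r)| <= `|c| * e by rewrite normrM ler_wpM2l.
  by rewrite mulrBr; move: hs; rewrite !ler_norml; lra.
(* The five terms are the errors [e * e], [|r| * e], [|s| * e] of [approxM] and those of replacing
   [r * s] by [h y * h z], with [|r| <= |h y| + 1] and [|s| <= |h z| + 1]. *)
- move=> y z; apply: (@eq_of_dist_le _ (1 + 2 * (`|h y| + 1) + 2 * (`|h z| + 1))).
  move=> e e0 e1; have [n [r [s [nr ns hr hs]]]] := h2 y z e e0.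
  have := hh _ _ _ _ (approxM (node1 _) (nodeA _) nr ns) => h3.
  have r1 : `|r| <= `|h y| + 1.
    have := ler_normD (r - h y) (h y); rewrite subrK distrC; lra.
  have s1 : `|s| <= `|h z| + 1.
    have := ler_normD (s - h z) (h z); rewrite subrK distrC; lra.
  have h4 : `|(h y - r) * h z| <= e * (`|h z| + 1).
    by rewrite normrM ler_pM// lerDl.
  have h5 : `|r * (h z - s)| <= (`|h y| + 1) * e by rewrite normrM ler_pM.
  have h6 : `|r| * e <= (`|h y| + 1) * e by rewrite ler_pM2r.
  have h7 : `|s| * e <= (`|h z| + 1) * e by rewrite ler_pM2r.
  have h8 : e * e <= e by rewrite ger_pMl.
  have -> : h (y * z) - h y * h z =
    (h (y * z) - r * s) - (h y - r) * h z - r * (h z - s) by ring.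
  apply: le_trans (ler_normB _ _) _.
  apply: le_trans (lerD (ler_normB _ _) (lexx _)) _; lra.
- have n1 : approx (node (branch x 0)) 1 1 0.
    by rewrite -[X in approx _ X]scale1r; exact: approx_cst.
  by apply/eqP; rewrite -subr_eq0 -normr_le0; exact: hh n1.
by exists alpha => y n r e; rewrite alphaE; exact: hh.
Qed.

Hypothesis hX : [set: character A] !=set0.

(** The default character off the root cell is invisible to the measure, which vanishes there. *)
Definition spectral (x : R) : charspace hX :=
  if pselect (cell [::] x) is left h then projT1 (cid (ex_follows h)) else point.

Lemma spectralP x : cell [::] x -> follows x (char_eval (spectral x)).
Proof.
by rewrite /spectral; case: pselect => // h _; case: cid.
Qed.

End Branch.

(** * The character space *)

Lemma cvg_initial (S : choiceType) (T : topologicalType) (f : S -> T)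
    (F : set_system S) (s : S) : Filter F ->
  f @ F --> f s -> F --> (s : initial_topology f).
Proof.
move=> FF h U; rewrite nbhsE /= => -[V [[C oC <-] Ca] VU].
by apply: filterS VU _; apply: h; exact: open_nbhs_nbhs.
Qed.

Section CharacterSpace.
Context {R : realType} {A : comAlgType R} (hX : [set: character A] !=set0).
Implicit Types (alpha : charspace hX) (x y : A).

Lemma char_eval_continuous y : continuous (fun alpha : charspace hX => char_eval alpha y).
Proof.
move=> alpha.
apply: (@continuous_comp _ _ _ (@char_eval _ _ hX) (fun f : {ptws A -> R} => f y)).
  exact: initial_continuous.
exact: (@proj_continuous A (fun=> R) y).
Qed.

Lemma char_eval_inj : injective (@char_eval R A hX).
Proof.
case=> [f [[fa] [fm] [fs]]] [g [[ga] [gm] [gs]]].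
move=> E; have {}E : f = g := E; subst g.
by rewrite (Prop_irrelevance fa ga) (Prop_irrelevance fm gm) (Prop_irrelevance fs gs).
Qed.

Lemma charspace_cvg (F : set_system (charspace hX)) alpha : Filter F ->
  (forall y, (fun beta => char_eval beta y) @ F --> char_eval alpha y) ->
  F --> alpha.
Proof.
move=> FF h; apply: cvg_initial; apply/cvg_sup => y; apply: cvg_initial.
exact: h.
Qed.

Lemma charspace_hausdorff : hausdorff_space (charspace hX).
Proof.
move=> alpha beta; rewrite cluster_cvgE => -[G GF [Ga Gb]].
have lim gamma y : G --> gamma ->
    (fun beta => char_eval beta y) @ G --> (char_eval gamma y : R).
  by move=> h; apply: cvg_comp h (@char_eval_continuous y gamma).
apply: char_eval_inj; apply/funext => y.
by apply: (cvg_unique (@Rhausdorff R)) (lim _ y _) (lim _ y _).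
Qed.

(** An ultrafilter on this set converges at every [y], by compactness of [[- N y, N y]], and the
    pointwise limit is again a character with the same bounds. *)
Lemma compact_bounded_characters (N : A -> R) :
  compact [set alpha : charspace hX | forall y, `|char_eval alpha y| <= N y].
Proof.
rewrite compact_ultra => F FU FN.
have lim y : exists l, (fun beta : charspace hX => char_eval beta y) @ F --> (l : R).
  pose ev (beta : charspace hX) := char_eval beta y : R.
  have [|l [_ cl]] := @segment_compact R (- N y) (N y) (ev @ F) _.
    suff : F (ev @^-1` `[- N y, N y]%classic) by [].
    by apply: filterS FN => beta /(_ y) /=; rewrite in_itv/= -ler_norml.
  exists l => B lB; case: (in_ultra_setVsetC (ev @^-1` B) FU) => // FB.
  by have [z []] := cl (~` B) B FB lB.
have [h hlim] := choice lim.
have uniq (f : charspace hX -> R) (l l' : R) : f @ F --> l -> f @ F --> l' -> l = l'.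
  by move=> h1 h2; exact: (cvg_unique (@Rhausdorff R) h1 h2).
have [|||alpha alphaE] := @ex_character _ _ h.
- move=> c y z; apply: (uniq (fun beta => char_eval beta (c *: y + z))) => //.
  under eq_fun do rewrite /char_eval linearP.
  exact: cvgD (cvgM (cvg_cst c) (hlim y)) (hlim z).
- move=> y z; apply: (uniq (fun beta => char_eval beta (y * z))) => //.
  under eq_fun do rewrite /char_eval rmorphM.
  exact: cvgM (hlim y) (hlim z).
- apply: (uniq (fun beta => char_eval beta 1)) => //.
  under eq_fun do rewrite /char_eval rmorph1.
  exact: cvg_cst.
exists (alpha : charspace hX); split=> [y|]; last first.
  by apply: charspace_cvg => y; rewrite [X in _ --> X]alphaE.
rewrite /= /char_eval alphaE; apply/ler_addgt0Pr => e e0.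
rewrite leNgt; apply/negP => hN.
have FN' : F [set beta | N y + e < `|char_eval beta y|].
  exact: (cvgr_norm_gt _ (hlim y) _ hN).
have [beta [/= b1 /(_ y) b2]] := filter_ex (filterI FN' FN).
by move: b1; rewrite ltNge (le_trans b2)// lerDl ltW.
Qed.

End CharacterSpace.

(** * The image measure *)

Section ImageMeasure.
Context {R : realType} {T : ptopologicalType}.
Variables (f : R -> T) (D : set R).
Hypotheses (cD : countable D) (cf : forall x, ~ D x -> {for x, continuous f}).

(** The preimage of an open set is its own interior together with points of [D], which form a
    countable, hence Borel, set. *)
Lemma measurable_continuous_off_countable :
  measurable_fun [set: measurableTypeR R] (f : measurableTypeR R -> borel T).
Proof.
refine (@measurability _ _ (measurableTypeR R) (borel T) setT f (@open T) erefl _).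
move=> _ [U oU <-]; rewrite setTI.
have -> : f @^-1` U = (f @^-1` U)° `|` (f @^-1` U `&` D).
  apply/seteqP; split=> [x Ux|x []]; last 2 first.
  - exact: interior_subset.
  - by case.
  have [Dx|nDx] := pselect (D x); [by right|left].
  by apply: (cf nDx); exact: open_nbhs_nbhs.
apply: measurableU; first by apply: open_measurable; exact: open_interior.
apply: (@countable_measurable _ (measurableTypeR R)).
  by move=> x; exact: measurable_set1.
by apply: sub_countable cD; apply: subset_card_le; exact: subIsetr.
Qed.

Hypothesis hT : hausdorff_space T.

Lemma radon_image (S : set (measurableTypeR R)) (mS : measurable S)
    (nu : {measure set (borel T) -> \bar R}) : (lebesgue_measure S < +oo)%E ->
  (forall B, measurable B -> nu B = lebesgue_measure (f @^-1` B `&` S)) ->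
  radon nu.
Proof.
move=> Sfin nuE; have mf := measurable_continuous_off_countable.
have mfB B : measurable (B : set (borel T)) -> measurable (f @^-1` B `&` S).
  by move=> mB; apply: measurableI => //; rewrite -[X in measurable X]setTI; exact: mf.
split=> [x|B mB].
  exists setT; first by split; [exact: openT|].
  by rewrite nuE// preimage_setT setTI.
have mK K : compact K -> measurable (K : set (borel T)).
  move=> cK; rewrite -[K]setCK; apply: measurableC; apply: sub_sigma_algebra.
  by apply: closed_openC; exact: compact_closed.
apply/eqP; rewrite eq_le; apply/andP; split; last first.
  apply: ge_ereal_sup => _ [K [cK KB] <-].
  by apply: le_measure; rewrite ?inE//; exact: mK.
have mD : measurable (D : set (measurableTypeR R)).
  by apply: (@countable_measurable _ (measurableTypeR R)) => // x; exact: measurable_set1.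
pose E : set (measurableTypeR R) := (f @^-1` B `&` S) `\` D.
have mE : measurable E by apply: measurableD => //; exact: mfB.
have BE : nu B = lebesgue_measure E.
  rewrite nuE// (measureDI (@lebesgue_measure R) (mfB _ mB) mD) -[RHS]adde0.
  congr (_ + _)%E.
  apply: countable_lebesgue_measure0; apply: sub_countable cD.
  by apply: subset_card_le; exact: subIsetr.
rewrite BE; apply/lee_addgt0Pr => e e0.
have Efin : (lebesgue_measure E < +oo)%E.
  apply: le_lt_trans Sfin; apply: le_measure; rewrite ?inE// => x [[]].
  by [].
have [V [cV VE ltV]] := lebesgue_regularity_inner mE Efin e0.
have cfV : compact (f @` V).
  apply: continuous_compact => //; apply: continuous_in_subspaceT => x.
  by rewrite inE => /VE[_ nDx]; exact: cf.
have mV : measurable (V : set (measurableTypeR R)) by exact: compact_measurable.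
rewrite (measureDI (@lebesgue_measure R) mE mV) addeC; apply: leeD; last exact: ltW.
rewrite (setIidr VE).
apply: (@le_trans _ _ (nu (f @` V))); last first.
  by apply: ereal_sup_ubound; exists (f @` V) => //; split=> // _ [x /VE[[]] + _ _ <-].
rewrite nuE; last exact: mK.
apply: le_measure; rewrite ?inE//; first by apply: mfB; exact: mK.
by move=> x Vx; split; [exists x|have [[]] := VE _ Vx].
Qed.

End ImageMeasure.

(** * The image of the Lebesgue measure on the character space *)

Section SpectralMeasure.
Context {R : realType} {A : comAlgType R} {m : nat}.
Variables (L : {scalar A}) (a : 'I_m -> A).
Hypotheses (L1 : L 1 = 1) (pL : pos L 1) (aL : archimedean L) (ha : generates a).
Hypothesis hX : [set: character A] !=set0.

Local Notation node := (node L a).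
Local Notation mass := (mass L a).
Local Notation left_end := (left_end L a).
Local Notation cell := (cell L a).
Local Notation branch := (branch L a).
Local Notation Phi := (spectral pL aL ha hX).

Lemma cell_itv s : cell s = `[left_end s, left_end s + mass s[%classic.
Proof. by apply/seteqP; split=> x; rewrite /= in_itv. Qed.

Lemma measurable_cell s : measurable (cell s : set (measurableTypeR R)).
Proof. by rewrite cell_itv; exact: measurable_itv. Qed.

Lemma lebesgue_cell s : lebesgue_measure (cell s) = (mass s)%:E.
Proof.
rewrite cell_itv lebesgue_measure_itv/= lte_fin.
case: ltP => [_|]; first by rewrite -EFinD addrAC subrr add0r.
have := mass_ge0 a pL aL s => m0 m1; congr (_%:E).
by apply/eqP; rewrite eq_le m0/= -(lerD2l (left_end s)) addr0.
Qed.

Lemma cell_sub s : cell s `<=` cell [::].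
Proof.
elim: s => // c s IH x xs; apply: IH; rewrite (cell_split a pL aL).
by case: c xs; [right|left].
Qed.

(** [None] stands for 1, the right end of the root cell. *)
Definition endpoints : set R := range (oapp left_end 1).

Lemma countable_endpoints : countable endpoints.
Proof.
apply: sub_countable (countableP [set: option (seq bool)]); exact: card_image_le.
Qed.

Lemma spectral_near x y e : cell [::] x -> 0 < e -> exists n,
  forall x', cell (branch x n) x' ->
    `|char_eval (Phi x) y - char_eval (Phi x') y| <= e *+ 2.
Proof.
move=> x0 e0; have [n /(_ n (leqnn n))[r nr]] := ex_approx pL aL ha x y e0.
exists n => x' xx'; have x'0 : cell [::] x' by exact: cell_sub xx'.
have h1 := spectralP pL aL ha hX x0 nr.
have := spectralP pL aL ha hX x'0 (y := y) (n := n) (r := r) (e := e).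
have <- : branch x n = branch x' n.
  by rewrite -(cell_branch pL aL xx') size_branch.
move=> /(_ nr) h2.
rewrite (_ : _ - _ = (char_eval (Phi x) y - r) - (char_eval (Phi x') y - r)).
  by apply: le_trans (ler_normB _ _) _; rewrite mulr2n lerD.
by ring.
Qed.

(** A point of [[0, 1[] that is no endpoint is interior to each of its cells, and [spectral_near]
    applies. Near a point outside [[0, 1]] the map is constant. *)
Lemma spectral_continuous x : ~ endpoints x -> {for x, continuous Phi}.
Proof.
move=> nDx; have [x0|nx0] := pselect (cell [::] x); last first.
  suff : \forall x' \near x, Phi x = Phi x'.
    by move=> h; apply: cvg_near_cst; apply: filterS h => x' ->.
  have PhiE x' : ~ cell [::] x' -> Phi x' = point.
    by rewrite /spectral; case: pselect.
  have [h|h] := ltP x 0; [near=> x'|have h1 : 1 < x].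
  - rewrite !PhiE// /cell/= => /andP[+ _]; rewrite leNgt => /negP; apply.
    by near: x'; exact: lt_nbhsl.
  - rewrite ltNge; apply/negP => x1; have {}x1 : x < 1.
      by rewrite lt_neqAle x1 andbT; apply/negP => /eqP E; apply: nDx; exists None.
    by apply: nx0; rewrite /cell/= h add0r /mass/= L1.
  near=> x'.
  rewrite !PhiE// /cell/= => /andP[_]; rewrite add0r /mass/= L1 ltNge.
  by move=> /negP; apply; apply: ltW; near: x'; exact: lt_nbhsr.
apply: charspace_cvg => y; apply/cvgrPdist_le => e e0.
have [n hn] := spectral_near y x0 (divr_gt0 e0 (ltr0Sn R 1)).
have : x \in `]left_end (branch x n), left_end (branch x n) + mass (branch x n)[.
  have /andP[l1 l2] := branch_cell pL aL n x0.
  rewrite in_itv/= l2 andbT lt_neqAle l1 andbT.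
  by apply/negP => /eqP E; apply: nDx; exists (Some (branch x n)).
move=> /near_in_itvoo; apply: filterS => x'; rewrite in_itv => /andP[/ltW l1 l2].
have := hn x'; rewrite mulr2n -splitr; apply.
by rewrite /cell/= l1.
Unshelve. all: by end_near. Qed.

Lemma measurable_spectral : measurable_fun [set: measurableTypeR R]
  (Phi : measurableTypeR R -> borel (charspace hX)).
Proof.
exact: measurable_continuous_off_countable countable_endpoints spectral_continuous.
Qed.

Definition unit_measure : {measure set (measurableTypeR R) -> \bar R} :=
  mrestr lebesgue_measure (measurable_cell [::]).

Definition spectral_measure : {measure set (borel (charspace hX)) -> \bar R} :=
  measure_function_pushforward__canonical__measure_function_Measure
    unit_measure measurable_spectral.

Lemma radon_spectral_measure : radon spectral_measure.
Proof.
apply: (radon_image countable_endpoints spectral_continuous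
  (@charspace_hausdorff _ _ hX) (measurable_cell [::])) => //.
by rewrite lebesgue_cell ltry.
Qed.

End SpectralMeasure.

Lemma closed_supp (R : realType) (T : ptopologicalType)
  (mu : {measure set (borel T) -> \bar R}) : closed (supp mu).
Proof.
move=> x clx U [oU Ux]; have [|y [Uy yU]] := clx U.
  exact: open_nbhs_nbhs.
by apply: Uy; split.
Qed.

Lemma measurable_char_eval (R : realType) (A : comAlgType R)
    (hX : [set: character A] !=set0) (y : A) :
  measurable_fun [set: borel (charspace hX)]
    (fun alpha : borel (charspace hX) => char_eval (alpha : charspace hX) y : R).
Proof.
apply: (measurability _ (RGenOpens.measurableE R)).
move=> _ [_ [c [d ->] <-]]; rewrite setTI; apply: sub_sigma_algebra.
have /continuousP := @char_eval_continuous _ _ hX y; apply; exact: interval_open.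
Qed.

(** * Integration against the spectral measure *)

Section Integral.
Context {R : realType} {A : comAlgType R} {m : nat}.
Variables (L : {scalar A}) (a : 'I_m -> A).
Hypotheses (L1 : L 1 = 1) (pL : pos L 1) (aL : archimedean L) (ha : generates a).
Hypothesis hX : [set: character A] !=set0.

Local Notation node := (node L a).
Local Notation mass := (mass L a).
Local Notation cell := (cell L a).
Local Notation Phi := (spectral pL aL ha hX).
Local Notation lambda := (unit_measure L a).

Let ev (y : A) (x : measurableTypeR R) : R := char_eval (Phi x) y.

Lemma spectral_bound y : exists N : R, forall x, cell [::] x -> `|ev y x| <= N.
Proof.
have [N [N1 N2]] := archimedean_bound pL aL y; exists N%:R => x x0.
have := @spectralP _ _ _ _ _ pL aL ha hX x x0 y 0%N 0 N%:R.
by rewrite subr0; apply; rewrite /approx scale0r subr0.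
Qed.

Lemma unit_measure_cell s : lambda (cell s) = (mass s)%:E.
Proof.
rewrite /= /mrestr (setIidl _); first exact: lebesgue_cell.
exact: cell_sub.
Qed.

Lemma unit_measureT : lambda setT = 1%:E.
Proof.
by rewrite /= /mrestr setTI lebesgue_cell// /mass/= L1.
Qed.

Lemma measurable_ev y : measurable_fun setT (ev y).
Proof.
exact: (measurableT_comp (@measurable_char_eval _ _ hX y)
  (@measurable_spectral _ _ _ _ _ L1 pL aL ha hX)).
Qed.

Lemma integrable_ev y D : measurable D -> lambda.-integrable D (EFin \o ev y).
Proof.
move=> mD; apply: (integrableS measurableT) => //.
apply: measurable_bounded_integrable => //.
- by rewrite unit_measureT ltry.
- exact: measurable_ev.
have [N NP] := spectral_bound y.
pose p : charspace hX := point.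
(* The second bound covers the default character taken off the root cell. *)
exists (Num.max N `|char_eval p y|); split; first exact: num_real.
move=> z; rewrite gt_max => /andP[Nz pz] x _ /=.
have [x0|x0] := pselect (cell [::] x); first by rewrite (le_trans (NP _ x0))// ltW.
by rewrite /ev /spectral; case: pselect => // _; exact: ltW.
Qed.

(** At depth [n] the integral and [node s y] are both within [e * mass s] of [r * mass s]. Going up,
    errors add exactly as masses do. *)
Lemma integral_cell y e n : (forall s, size s = n -> exists r, approx (node s) y r e) ->
  forall k s, (k + size s)%N = n ->
  `|\int[lambda]_(x in cell s) ev y x - node s y| <= e *+ 2 * mass s.
Proof.
move=> hn; have mc s : measurable (cell s : set (measurableTypeR R)).
  exact: measurable_cell.
elim=> [s sn|k IH s sn].
  have [r nr] := hn s sn.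
  have h1 := approx_le nr; rewrite -/(mass s) in h1.
  have evr x : cell s x -> `|ev y x - r| <= e.
    move=> xs; apply: (@spectralP _ _ _ _ _ pL aL ha hX x _ y (size s)).
      exact: cell_sub xs.
    by rewrite (cell_branch pL aL xs).
  have icst c : lambda.-integrable (cell s) (EFin \o (cst c : _ -> R)).
    apply: measurable_bounded_integrable => //.
      by rewrite unit_measure_cell ltry.
    by exists `|c|; split=> [|z cz x _ /=]; [exact: num_real|exact: ltW].
  have up : \int[lambda]_(x in cell s) ev y x <= (r + e) * mass s.
    have := @le_Rintegral _ _ _ lambda _ (ev y) (cst (r + e)) (mc s)
      (integrable_ev y (mc s)) (icst _).
    rewrite Rintegral_cst// unit_measure_cell; apply => x /evr.
    by rewrite ler_distl => /andP[].
  have lo : (r - e) * mass s <= \int[lambda]_(x in cell s) ev y x.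
    have := @le_Rintegral _ _ _ lambda _ (cst (r - e)) (ev y) (mc s)
      (icst _) (integrable_ev y (mc s)).
    rewrite Rintegral_cst// unit_measure_cell; apply => x /evr.
    by rewrite ler_distl => /andP[].
  move: h1 up lo; rewrite mulrDl mulrBl mulrnAl mulr2n !ler_norml.
  by move=> /andP[? ?]; lra.
rewrite (cell_split a pL aL s) Rintegral_setU//; last 2 first.
- by apply: integrable_ev; exact: measurableU.
- exact: cell_disj.
rewrite (node_split a pL aL) (mass_split a pL aL) mulrDr opprD addrACA.
apply: le_trans (ler_normD _ _) _; apply: lerD; apply: IH; rewrite /= -sn; lia.
Qed.

Lemma integral_ev y : \int[lambda]_x ev y x = L y.
Proof.
have mc := measurable_cell L a [::].
rewrite -(setUv (cell [::])) Rintegral_setU//; last 3 first.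
- exact: measurableC.
- by apply: integrable_ev; rewrite setUv.
- exact/disj_setPCl.
have -> : \int[lambda]_(x in ~` cell [::]) ev y x = 0.
  rewrite /Rintegral null_set_integral//; first exact: measurableC.
    by apply/measurable_EFinP; apply: measurable_funTS; exact: measurable_ev.
  by rewrite /= /mrestr setICl measure0.
rewrite addr0; apply: (@eq_of_dist_le _ 2) => e e0 _.
have [N /(_ e e0)[n hn]] := localized_all pL aL ha y.
have hs s : size s = n -> exists r, approx (node s) y r e.
  by move=> sn; have [|r [_ nr]] := hn s; [rewrite sn|exists r].
have := integral_cell hs (addn0 n : (n + size ([::] : seq bool))%N = n).
by rewrite /mass/= L1 mulr1 -mulr_natr.
Qed.

Lemma spectral_represents : represents (spectral_measure L1 pL aL ha hX) L.
Proof.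
move=> y.
have mev : measurable_fun [set: borel (charspace hX)]
  (EFin \o (fun alpha : borel (charspace hX) => char_eval (alpha : charspace hX) y)).
  by apply/measurable_EFinP; exact: measurable_char_eval.
have iev := integrable_ev y measurableT.
have mPhi := @measurable_spectral _ _ _ _ _ L1 pL aL ha hX.
split.
  exact: (integrable_pushforward mPhi mev iev measurableT).
transitivity (\int[lambda]_x (ev y x)%:E)%E.
  rewrite -integral_ev /Rintegral fineK//.
  exact: (integrable_fin_num measurableT iev).
exact/esym/(integral_pushforward mPhi mev iev measurableT).
Qed.

(** The open set where [|alpha y| > N y] has no preimage in the root cell, so it misses the support,
    which thus lies in a compact set of bounded characters. *)
Lemma compact_supp_spectral : compact (supp (spectral_measure L1 pL aL ha hX)).
Proof.
have [N NP] := choice spectral_bound.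
apply: subclosed_compact; [exact: closed_supp| |].
  exact: (@compact_bounded_characters _ _ hX N).
move=> alpha sa y; rewrite /= leNgt; apply/negP => Na.
pose U := [set beta : charspace hX | N y < `|char_eval beta y|].
have oU : open U.
  apply: (@open_comp _ _ (fun beta : charspace hX => char_eval beta y : R)
    [set z | N y < `|z|]) => [beta _|]; first exact: char_eval_continuous.
  have /continuousP := @norm_continuous _ R; move=> /(_ [set z | N y < z]).
  by apply; exact: open_gt.
have := sa U (conj oU Na).
rewrite /= /pushforward /= /mrestr (_ : _ `&` _ = set0) ?measure0 ?ltxx//.
by apply/seteqP; split=> // x [/= h /(NP y)]; rewrite /ev leNgt => /negP; apply.
Qed.

End Integral.

(** * Growth of moments *)

(** By Bernoulli's inequality [(r / s) ^+ n] grows at least linearly; [s = 0] is settled by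
    [n = 1]. *)
Lemma le0_of_geometric (R : realType) (r s b G : R) : 0 <= s -> s < r ->
  (forall n, r ^+ n * b <= s ^+ n * G) -> b <= 0.
Proof.
move=> s0 sr h; have r0 : 0 < r by exact: le_lt_trans sr.
move: s0; rewrite le_eqVlt => /predU1P[s0|s0].
  by have := h 1%N; rewrite -s0 !expr1 mul0r pmulr_rle0.
rewrite leNgt; apply/negP => b0.
pose d := r / s - 1.
have d0 : 0 < d by rewrite subr_gt0 ltr_pdivlMr// mul1r.
have bern n : 1 + n%:R * d <= (r / s) ^+ n.
  elim: n => [|n IH]; first by rewrite mul0r addr0.
  have E : r / s = d + 1 by rewrite subrK.
  rewrite exprSr [X in _ <= _ * X]E.
  have : (1 + n%:R * d) * (d + 1) <= (r / s) ^+ n * (d + 1).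
    by rewrite ler_pM2r// ltr_wpDl// ltW.
  apply: le_trans; rewrite -natr1.
  have : 0 <= n%:R * d * d by rewrite !mulr_ge0// ltW.
  by move: (n%:R : R) => k hk; lra.
have : d <= 0.
  apply: (@le0_of_bounded_multiples _ _ (G / b)) => n.
  apply: (@le_trans _ _ ((r / s) ^+ n)).
    by apply: le_trans (bern n); rewrite lerDr.
  by rewrite ler_pdivlMr// expr_div_n mulrAC ler_pdivrMr ?exprn_gt0// (mulrC G).
by rewrite leNgt d0.
Qed.

Section Growth.
Context {R : realType} {A : comAlgType R}.
Variable (L : {scalar A}).
Hypotheses (L_psd : psd L) (L1 : L 1 = 1).

Lemma psd_pos : pos L 1. Proof. by move=> y; rewrite mul1r. Qed.

Lemma v_growth p : (v_ L p < +oo)%E -> exists s : R, [/\ 0 <= s,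
  v_ L p = (Num.sqrt s)%:E & forall n, L (p ^+ (2 * n)) <= s ^+ n].
Proof.
rewrite /v_; set S := ereal_sup _ => Sfin.
have ratio n : L (p ^+ (2 * n)) != 0 ->
    ((L (p ^+ (2 * n + 2)) / L (p ^+ (2 * n)))%:E <= S)%E.
  by move=> Ln; apply: ereal_sup_ubound; exists n.
have even n : 0 <= L (p ^+ (2 * n)) by rewrite mulnC exprM.
(* The ratio for [n = 0], where the denominator is [L 1 = 1], excludes a supremum equal to [-oo]. *)
have S0 : (0 <= S)%E.
  apply: le_trans (ratio 0%N _); last by rewrite expr0 L1 oner_neq0.
  by rewrite lee_fin expr0 L1 divr1 (even 1%N).
move: S0 Sfin ratio; case: S => [s||]//= s0 _ ratio.
exists s; split => //.
elim=> [|n IH]; first by rewrite muln0 !expr0 L1.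
rewrite mulnS addnC exprSr; have [Ln|Ln] := eqVneq (L (p ^+ (2 * n))) 0.
  (* Where the supremum skips a ratio, Cauchy-Schwarz for [p ^+ n] and [p ^+ n.+2] makes the next
     even moment vanish too. *)
  suff -> : L (p ^+ (2 * n + 2)) = 0 by rewrite mulr_ge0// exprn_ge0.
  have := cauchy_schwarz (p ^+ n) (p ^+ n.+2) psd_pos.
  rewrite !mul1r -exprM mulnC Ln mul0r -exprD => h.
  apply/eqP; rewrite -sqrf_eq0 eq_le sqr_ge0 andbT; apply: le_trans h.
  by rewrite (_ : 2 * n + 2 = n + n.+2)%N//; lia.
have Ln0 : 0 < L (p ^+ (2 * n)) by rewrite lt_neqAle eq_sym Ln even.
have := ratio n Ln; rewrite lee_fin ler_pdivrMr// => /le_trans; apply.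
by rewrite mulrC ler_wpM2r.
Qed.

(** The sequence [b n] is log-convex by Cauchy-Schwarz. If [b 1 > s * b 0], it grows at least like
    [r ^+ n] with [r > s], against [b n ^+ 2 <= L (p ^+ (4 * n)) * L (y ^+ 4) <= s ^+ (2 * n) * L (y
    ^+ 4)]. *)
Lemma pos_of_growth p s : 0 <= s -> (forall n, L (p ^+ (2 * n)) <= s ^+ n) ->
  pos L (s%:A - p ^+ 2).
Proof.
move=> s0 growth y; rewrite mulrBl linearB scalarMA subr_ge0.
pose b n := L (p ^+ (2 * n) * y ^+ 2).
have even n : p ^+ (2 * n) = (p ^+ n) ^+ 2 by rewrite mulnC exprM.
have b_ge0 n : 0 <= b n by rewrite /b even; exact: (pos_sq _ psd_pos).
have -> : L (p ^+ 2 * y ^+ 2) = b 1%N by [].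
have -> : L (y ^+ 2) = b 0%N by rewrite /b expr0 mul1r.
have b_cvx n : b n.+1 ^+ 2 <= b n * b n.+2.
  have pn : pos L (p ^+ (2 * n)) by rewrite even; exact: (pos_sq _ psd_pos).
  have := cauchy_schwarz y (p ^+ 2 * y) pn.
  rewrite /b !mulnS !exprD => h; apply: le_trans (le_trans _ h) _.
    by rewrite le_eqVlt; apply/orP; left; apply/eqP; congr (L _ ^+ 2); ring.
  by rewrite le_eqVlt; apply/orP; left; apply/eqP; congr (_ * L _); ring.
rewrite leNgt; apply/negP => sb.
have b0 : 0 < b 0%N.
  rewrite lt_neqAle b_ge0 andbT; apply/negP => /eqP E.
  have := b_cvx 0%N; rewrite -E mul0r leNgt exprn_gt0//.
  by move: sb; rewrite -E mulr0.
pose r := b 1%N / b 0%N.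
have sr : s < r by rewrite ltr_pdivlMr.
have r0 : 0 < r by exact: le_lt_trans sr.
have step n : 0 < b n /\ r * b n <= b n.+1.
  elim: n => [|n [bn IH]]; first by rewrite divfK ?gt_eqF.
  have bn1 : 0 < b n.+1 by apply: lt_le_trans IH; exact: mulr_gt0.
  split=> //; rewrite -(ler_pM2l bn) mulrCA mulrA.
  apply: le_trans (b_cvx n); rewrite expr2; apply: ler_wpM2r => //; exact: ltW.
have geo n : r ^+ n * b 0%N <= b n.
  elim: n => [|n IH]; first by rewrite expr0 mul1r.
  by apply: le_trans (step n).2; rewrite exprS -mulrA ler_pM2l.
have : b 0%N ^+ 2 <= 0.
  apply: (@le0_of_geometric _ (r ^+ 2) (s ^+ 2) _ (L (y ^+ 4))).
  - exact: sqr_ge0.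
  - by rewrite ltr_pXn2r ?nnegrE// ltW.
  move=> n; rewrite -!exprM.
  apply: (@le_trans _ _ (b n ^+ 2)).
    rewrite mulnC exprM -exprMn ler_pXn2r ?nnegrE//.
    by rewrite mulr_ge0// ?exprn_ge0// ltW.
  have := cauchy_schwarz (p ^+ (2 * n)) (y ^+ 2) psd_pos.
  rewrite !mul1r -!exprM => /le_trans; apply; apply: ler_wpM2r.
    by rewrite (exprM y 2 2).
  by rewrite [(2 * n * 2)%N]mulnC.
by rewrite leNgt exprn_gt0.
Qed.

End Growth.

(** * From a bound on the sum of squares to the archimedean property *)

Section Archimedean.
Context {R : realType} {A : comAlgType R} {m : nat}.
Variables (L : {scalar A}) (a : 'I_m -> A).
Hypotheses (pL : pos L 1) (ha : generates a).

(** From [(1 - x)^2 >= 0] follows [2 x <= 1 + x^2 <= 1 + N]. *)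
Lemma archimedean_of_sq : (forall x, exists N : R, pos L (N%:A - x ^+ 2)) ->
  archimedean L.
Proof.
move=> h x; have [N pN] := h x.
exists (`|N| + 1); first by rewrite ltr_wpDl.
have -> : (`|N| + 1)%:A - x = (`|N| + 1 - 2^-1 * (N + 1))%:A +
    2^-1 *: ((N%:A - x ^+ 2) + (1 - x) ^+ 2).
  rewrite (@scalerBl _ _ (`|N| + 1)).
  have -> : (N%:A - x ^+ 2) + (1 - x) ^+ 2 = (N + 1)%:A - x *+ 2.
    by rewrite scalerDl scale1r; ring.
  by rewrite (@scalerBr _ _ 2^-1) half_double scaler_alg; ring.
apply: posD; first by apply: posA => //; have := ler_norm N; have := normr_ge0 N; lra.
apply: posZ; first by lra.
by apply: posD => //; exact: pos_sq.
Qed.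

(** Elements with bounded square form a subalgebra: sums use [(c u + v)^2 + (c u - v)^2 = 2 c^2 u^2
    + 2 v^2], products use [u^2 v^2 <= |N| v^2 <= |N| M]. *)
Lemma archimedean_of_generators :
  (forall i, exists N : R, pos L (N%:A - a i ^+ 2)) -> archimedean L.
Proof.
move=> h; apply: archimedean_of_sq => x.
pose S : {pred A} := fun x => `[< exists N : R, pos L (N%:A - x ^+ 2) >].
have SE y : (y \in S) = `[< exists N : R, pos L (N%:A - y ^+ 2) >] by [].
have weaken (N M : R) y : N <= M -> pos L (N%:A - y) -> pos L (M%:A - y).
  move=> NM pN; have -> : M%:A - y = (M - N)%:A + (N%:A - y).
    by rewrite scalerBl; ring.
  by apply: posD => //; apply: posA => //; rewrite subr_ge0.
suff subS : subalg_closed S.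
  by have /asboolP := ha subS (fun i => asboolT (h i)) x.
split=> [|c u v|u v]; rewrite !SE.
- by apply/asboolP; exists 1; rewrite scale1r expr1n subrr; exact: pos0.
- move=> /asboolP[N pN] /asboolP[M pM]; apply/asboolP.
  exists (2 * c ^+ 2 * N + 2 * M).
  have -> : (2 * c ^+ 2 * N + 2 * M)%:A - (c *: u + v) ^+ 2 =
      (2 * c ^+ 2) *: (N%:A - u ^+ 2) + 2 *: (M%:A - v ^+ 2) + (c *: u - v) ^+ 2.
    rewrite scalerDl -!scaler_alg !scalerBr.
    have -> : (2 * c ^+ 2) *: u ^+ 2 = 2 * (c *: u) ^+ 2.
      by rewrite exprZn -scalerA scaler_nat mulr_natl.
    have -> : 2 *: v ^+ 2 = 2 * v ^+ 2 by rewrite scaler_nat mulr_natl.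
    by ring.
  apply: posD; last exact: pos_sq.
  by apply: posD; apply: posZ => //; rewrite mulr_ge0// sqr_ge0.
move=> /asboolP[N pN] /asboolP[M pM]; apply/asboolP; exists (`|N| * M).
have -> : (`|N| * M)%:A - (u * v) ^+ 2 =
    `|N| *: (M%:A - v ^+ 2) + (`|N|%:A - u ^+ 2) * v ^+ 2.
  by rewrite scalerBr scaler_alg mulrBl mulr_algl; ring.
apply: posD; first exact: posZ.
by apply: posMsq; apply: weaken pN; exact: ler_norm.
Qed.

(** In the order of the cone, [a_i^2 <= p <= (p^2 + 1) / 2 <= (s + 1) / 2]. *)
Lemma archimedean_of_sum_sq s : pos L (s%:A - (\sum_(i < m) a i ^+ 2) ^+ 2) ->
  archimedean L.
Proof.
set p := \sum_(i < m) _ => ps; apply: archimedean_of_generators => i.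
exists (2^-1 * (s + 1)).
have pE : p = a i ^+ 2 + \sum_(j < m | j != i) a j ^+ 2 by rewrite /p (bigD1 i).
have -> : (2^-1 * (s + 1))%:A - a i ^+ 2 =
   2^-1 *: ((s%:A - p ^+ 2) + (1 - p) ^+ 2) + \sum_(j < m | j != i) a j ^+ 2.
  have -> : (s%:A - p ^+ 2) + (1 - p) ^+ 2 = (s + 1)%:A - p *+ 2.
    by rewrite scalerDl scale1r; ring.
  by rewrite (@scalerBr _ _ 2^-1) half_double scaler_alg pE; ring.
apply: posD.
  by apply: posZ; [lra|apply: posD => //; exact: pos_sq].
by elim/big_rec: _ => [|j x _ px]; [exact: pos0|apply: posD => //; exact: pos_sq].
Qed.

End Archimedean.

(** * Representing measures *)

(** A compact set off the support is covered by finitely many open null sets; inner regularity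
    carries this over to the whole complement. *)
Lemma radon_suppC (R : realType) (T : ptopologicalType)
    (mu : {measure set (borel T) -> \bar R}) : hausdorff_space T ->
  radon mu -> mu (~` supp mu) = 0%E.
Proof.
move=> hT [_ inner].
have mO (U : set T) : open U -> measurable (U : set (borel T)).
  by move=> oU; apply: sub_sigma_algebra.
have oS : open (~` supp mu) by apply: closed_openC; exact: closed_supp.
have ex x : exists U : set T, (~ supp mu x -> [/\ open U, U x & mu U = 0%E]).
  have [xS|nxS] := pselect (supp mu x); first by exists setT.
  have /existsNP[U /not_implyP[[oU Ux] /negP]] := nxS.
  rewrite -leNgt => U0; exists U => _; split=> //.
  by apply/eqP; rewrite eq_le U0 measure_ge0.
have [F FP] := choice ex.
apply/eqP; rewrite eq_le measure_ge0 andbT inner; last exact: mO.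
apply: ge_ereal_sup => _ [K [cK KS] <-].
move: (cK); rewrite compact_cover.
move=> /(_ T (~` supp mu) F)[x /FP[]//|x Kx|D' D'S KD'].
  by exists x; [exact: KS|have [] := FP _ (KS _ Kx)].
pose B0 : set (borel T) := \big[setU/set0]_(i <- finmap.enum_fset D') F i.
have [mF muF] : measurable B0 /\ mu B0 = 0%E.
  rewrite /B0 big_seq; apply: (big_ind (fun B : set (borel T) => measurable B /\ mu B = 0%E)).
  - by split; [exact: measurable0|exact: measure0].
  - move=> B C [mB muB] [mC muC]; split; first exact: measurableU.
    by apply/eqP; rewrite eq_le measure_ge0 andbT -[leRHS]adde0 -{1}muB -muC measureU2.
  - move=> i /D'S; rewrite inE => /FP[oF _ F0]; split => //; exact: mO.
rewrite -muF; apply: le_measure; rewrite ?inE//.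
  rewrite -[K]setCK; apply: measurableC; apply: mO.
  by apply: closed_openC; exact: compact_closed.
by rewrite /B0 -bigcup_fset.
Qed.

Section Representing.
Context {R : realType} {A : comAlgType R} (hX : [set: character A] !=set0).
Variables (L : {scalar A}) (mu : {measure set (borel (charspace hX)) -> \bar R}).
Hypotheses (L1 : L 1 = 1) (rep : represents mu L).

Let ev (y : A) (alpha : borel (charspace hX)) : R := char_eval (alpha : charspace hX) y.

Let iev y : mu.-integrable setT (EFin \o ev y). Proof. exact: (rep y).1. Qed.

Lemma representsE y : L y = \int[mu]_alpha ev y alpha.
Proof. by rewrite /Rintegral -(rep y).2. Qed.

Lemma represents_mass : mu setT = 1%E.
Proof.
have := (rep 1).2; rewrite L1 => ->.
rewrite (eq_integral (cst 1%E)) ?integral_cst ?mul1e//.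
by move=> alpha _; rewrite /char_eval rmorph1.
Qed.

(** A Markov inequality with two uses: [U] the support and [c = 0], giving positivity of [L y]; and
    [y] an even power of [p], with [U] a set where [p] is large. *)
Lemma represents_ge_on U c y : measurable U -> 0 <= c ->
  (forall alpha, U alpha -> c <= ev y alpha) ->
  (mu (~` U) = 0%E \/ forall alpha, 0 <= ev y alpha) ->
  c * fine (mu U) <= L y.
Proof.
move=> mU c0 cU off; have mUC : measurable (~` U) by exact: measurableC.
have iU V : measurable V -> mu.-integrable V (EFin \o ev y).
  by move=> mV; apply: (integrableS measurableT) => //; exact: iev.
rewrite representsE -(setUv U) Rintegral_setU//; last 2 first.
- by rewrite setUv; exact: iev.
- exact/disj_setPCl.
have Ufin : (mu U < +oo)%E.
  apply: (@le_lt_trans _ _ (mu setT)); first by apply: le_measure; rewrite ?inE.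
  by rewrite represents_mass ltry.
rewrite -[leLHS]addr0; apply: lerD.
  rewrite -(Rintegral_cst mu mU c); apply: le_Rintegral => //; last exact: iU.
  apply: measurable_bounded_integrable => //.
  by exists `|c|; split=> [|z cz x _ /=]; [exact: num_real|exact: ltW].
case: off => [mu0|ge0]; last by apply: Rintegral_ge0.
rewrite /Rintegral null_set_integral//.
by have /measurable_int := iU _ mUC.
Qed.

End Representing.

Unset Implicit Arguments.

Theorem theorem6p3 (R : realType) (A : comAlgType R) (m : nat)
    (a : 'I_m -> A) (ha : generates a)
    (hX : [set: character A] !=set0)
    (L : {scalar A}) (L_psd : psd L) (L1 : L 1 = 1) :
  ((exists mu : {measure set (borel (charspace hX)) -> \bar R},
      [/\ radon mu, compact (supp mu) & represents mu L])
   <-> (v_ L (\sum_(i < m) a i ^+ 2) < +oo)%E) /\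
  (forall mu : {measure set (borel (charspace hX)) -> \bar R},
     radon mu -> compact (supp mu) -> represents mu L ->
     supp mu `<=` [set alpha : charspace hX |
       ((\sum_(i < m) `|char_eval alpha (a i)| ^+ 2)%:E
         <= v_ L (\sum_(i < m) a i ^+ 2))%E]).
Proof.
have pL := psd_pos L_psd.
set p := \sum_(i < m) a i ^+ 2.
have pE (alpha : charspace hX) :
    \sum_(i < m) `|char_eval alpha (a i)| ^+ 2 = char_eval alpha p.
  rewrite /char_eval rmorph_sum; apply: eq_bigr => i _.
  by rewrite rmorphXn/= real_normK// num_real.
have evX (alpha : charspace hX) n : char_eval alpha (p ^+ n) = char_eval alpha p ^+ n.
  by rewrite /char_eval rmorphXn.
have evB (alpha : charspace hX) c x y :
    char_eval alpha (c *: x - y) = c * char_eval alpha x - char_eval alpha y.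
  by rewrite /char_eval linearB linearZ.
split; first split.
- move=> [mu [rmu cmu rep]].
  have [M M0 MP] : exists2 M : R, 0 <= M & forall alpha, supp mu alpha ->
      `|char_eval alpha p| <= M.
    have : compact ((fun alpha : charspace hX => char_eval alpha p : R) @` supp mu).
      apply: continuous_compact => //; apply: continuous_subspaceT.
      exact: char_eval_continuous.
    move=> /compact_bounded[M [_ Mb]].
    have h := Mb _ (le_lt_trans (ler_norm M) (ltr_pwDr ltr01 (lexx _))).
    exists (`|M| + 1); first by rewrite addr_ge0.
    by move=> alpha sa; apply: h; exists alpha.
  (* The element [M ^+ 2 *: p ^+ (2 * n) - p ^+ (2 * n + 2)] is nonnegative on the support, so every
     ratio in [v_ L p] is at most [M ^+ 2]. *)
  have bound n : L (p ^+ (2 * n + 2)) <= M ^+ 2 * L (p ^+ (2 * n)).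
    rewrite -scalarZ -subr_ge0 -linearB.
    have mS : measurable (supp mu : set (borel (charspace hX))).
      rewrite -[supp mu]setCK; apply: measurableC; apply: sub_sigma_algebra.
      by apply: closed_openC; exact: closed_supp.
    have := @represents_ge_on _ _ hX L mu L1 rep (supp mu) 0
      (M ^+ 2 *: p ^+ (2 * n) - p ^+ (2 * n + 2)) mS (lexx _).
    rewrite mul0r; apply; last first.
      by left; apply: radon_suppC => //; exact: charspace_hausdorff.
    move=> alpha /MP aM; rewrite evB !evX exprD [X in _ - X]mulrC -mulrBl mulr_ge0//.
      by rewrite subr_ge0 -[X in X <= _]real_normK ?num_real// ler_pXn2r ?nnegrE.
    by rewrite mulnC exprM sqr_ge0.
  apply: (@le_lt_trans _ _ (sqrte (M ^+ 2)%:E)); last by rewrite ltry.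
  rewrite /v_ lee_sqrt; last by rewrite lee_fin sqr_ge0.
  apply: ge_ereal_sup => _ [n /= Ln <-]; rewrite lee_fin.
  have Ln0 : 0 < L (p ^+ (2 * n)).
    by rewrite lt_neqAle eq_sym Ln mulnC exprM L_psd.
  by rewrite ler_pdivrMr.
(* Moment growth puts [s - p ^+ 2] into the cone, which makes the cone archimedean. *)
- move=> /(v_growth L_psd L1)[s [s0 _ growth]].
  have aL := archimedean_of_sum_sq pL ha (pos_of_growth L_psd s0 growth).
  exists (spectral_measure L1 pL aL ha hX); split.
  + exact: radon_spectral_measure.
  + exact: compact_supp_spectral.
  + exact: spectral_represents.
move=> mu rmu cmu rep alpha sa; rewrite /= pE.
have [vfin|] := boolP (v_ L p < +oo)%E; last first.
  by rewrite -leNgt leye_eq => /eqP ->; exact: leey.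
have [s [s0 -> growth]] := v_growth L_psd L1 vfin.
rewrite lee_fin leNgt; apply/negP => salpha.
(* The midpoint leaves room on both sides: [U] is a neighbourhood of [alpha], and [s < t ^+ 2] makes
   the geometric comparison strict. *)
pose t := (Num.sqrt s + char_eval alpha p) / 2.
have st : Num.sqrt s < t by rewrite /t; lra.
have t0 : 0 < t by apply: le_lt_trans st; exact: sqrtr_ge0.
have st2 : s < t ^+ 2.
  by rewrite -(sqr_sqrtr s0) ltr_pXn2r ?nnegrE ?sqrtr_ge0// ltW.
pose U := [set beta : charspace hX | t < char_eval beta p].
have oU : open U.
  apply: (@open_comp _ _ (fun beta : charspace hX => char_eval beta p : R)
    [set z | t < z]).
    by move=> beta _; exact: char_eval_continuous.
  exact: open_gt.
have Ua : U alpha by rewrite /U/= /t; lra.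
have muU := sa U (conj oU Ua).
have mU : measurable (U : set (borel (charspace hX))) by exact: sub_sigma_algebra.
have : fine (mu U) <= 0.
  apply: (le0_of_geometric s0 st2 (G := 1)) => n; rewrite mulr1.
  apply: le_trans (growth n); rewrite -exprM.
  apply: (represents_ge_on L1 rep mU); first by rewrite exprn_ge0// ltW.
    move=> beta /ltW Ub; rewrite evX; apply: lerXn2r => //; rewrite nnegrE.
      exact: ltW.
    by apply: le_trans Ub; exact: ltW.
  right=> beta; rewrite evX mulnC exprM; exact: sqr_ge0.
rewrite leNgt fine_gt0// muU/=.
apply: (@le_lt_trans _ _ (mu setT)); first by apply: le_measure; rewrite ?inE.
by rewrite (represents_mass L1 rep) ltry.
Qed.
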